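(* Let $n,m,l\in\mathbb{N}$, let $\Phi:\mathbb{M}_n\to\mathbb{M}_l$ and $\Psi:\mathbb{M}_m\to\mathbb{M}_l$ be strictly positive linear maps, let $f$ be a non-decreasing function on $(0,\infty)$ and $1<p\le2$, and assume that $x\mapsto f(x^{p-1})$ is convex on $(0,\infty)$. Let $q\in[-1,0]$. (1) If $\Phi$ is completely positive, then $(A,B)\in\mathbb{P}_n\times\mathbb{P}_m\mapsto\mathrm{Tr}\, f\bigl(\Phi(A^p)^{1/2}\Psi(B^q)\Phi(A^p)^{1/2}\bigr)$ is jointly convex. (2) If $n=l$ and $\Phi=\mathrm{id}$, then $(A,B)\in\mathbb{P}_n\times\mathbb{P}_m\mapsto\mathrm{Tr}\, f\bigl((\Phi(A^{-p})^{1/2}\Psi(B^{-q})\Phi(A^{-p})^{1/2})^{-1}\bigr)$ is jointly convex.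
   Context: $\mathbb{M}_n$: $n\times n$ complex matrices; $\mathbb{P}_n$: positive definite ones; $\mathrm{Tr}$: usual trace. A linear map is strictly positive if it maps positive definite matrices to positive definite matrices. *)

(* Defs.v *)
(* complex matrices over R[i] (R : realType), spectral.v,
   real powers via mathcomp-analysis powR. *)
From HB Require Import structures.
From mathcomp Require Import all_boot all_order all_algebra.
From mathcomp Require Import sesquilinear spectral.
From mathcomp Require Import complex.
From mathcomp Require Import reals exp.
Set Implicit Arguments. Unset Strict Implicit. Unset Printing Implicit Defensive.
Import Order.TTheory GRing.Theory Num.Theory.
Local Open Scope ring_scope.
Local Open Scope sesquilinear_scope.

Section Defs.
Variable R : realType.
Local Notation C := (R[i]).

(* embedding of reals into complex numbers *)
Definition rC (t : R) : C := Complex t 0.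

(* positive definite / positive semidefinite complex matrices *)
Definition posdef n (A : 'M[C]_n) : Prop :=
  A \is hermsymmx /\ forall v : 'rV[C]_n, v != 0 -> 0 < (v *m A *m v ^t*) 0 0.
Definition possemidef n (A : 'M[C]_n) : Prop :=
  A \is hermsymmx /\ forall v : 'rV[C]_n, 0 <= (v *m A *m v ^t*) 0 0.

(* functional calculus f(A) for a Hermitian matrix A, via the spectral
   decomposition A = P^-1 diag(d) P (P unitary, d real) of spectral.v *)
Definition mxfun (f : R -> R) n (A : 'M[C]_n) : 'M[C]_n :=
  invmx (spectralmx A) *m
    diag_mx (map_mx (fun z : C => rC (f (complex.Re z))) (spectral_diag A)) *m
    spectralmx A.

(* real power A^p (for positive definite A) *)
Definition mxpow n (A : 'M[C]_n) (p : R) : 'M[C]_n := mxfun (fun x => powR x p) A.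

(* Tr f(X), a real number for Hermitian X *)
Definition trf (f : R -> R) n (X : 'M[C]_n) : R := complex.Re (\tr (mxfun f X)).

(* strictly positive linear map: P_n -> P_l *)
Definition strictly_positive n l (Phi : 'M[C]_n -> 'M[C]_l) : Prop :=
  forall A, posdef A -> posdef (Phi A).

(* completely positive: id_{M_k} (x) Phi is positive for every k *)
Definition completely_positive n l (Phi : 'M[C]_n -> 'M[C]_l) : Prop :=
  forall k (X : 'I_k -> 'I_k -> 'M[C]_n),
    possemidef (\mxblock_(i < k, j < k) X i j) ->
    possemidef (\mxblock_(i < k, j < k) Phi (X i j)).

(* joint convexity on P_n x P_m of a real-valued function *)
Definition jointly_convex n m (F : 'M[C]_n -> 'M[C]_m -> R) : Prop :=
  forall A1 A2 B1 B2, posdef A1 -> posdef A2 -> posdef B1 -> posdef B2 ->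
  forall t : R, 0 <= t <= 1 ->
    F (rC t *: A1 + rC (1 - t) *: A2) (rC t *: B1 + rC (1 - t) *: B2)
      <= t * F A1 B1 + (1 - t) * F A2 B2.

(* f non-decreasing on (0, oo) *)
Definition nondecreasing_pos (f : R -> R) : Prop :=
  forall x y, 0 < x -> x <= y -> f x <= f y.

(* g convex on (0, oo) *)
Definition convex_pos (g : R -> R) : Prop :=
  forall x y t, 0 < x -> 0 < y -> 0 <= t <= 1 ->
    g (t * x + (1 - t) * y) <= t * g x + (1 - t) * g y.

End Defs.

(* Main.v *)
(* Put g(x) = f(x^(p-1)); composing with a concave power shows that f is convex.
   The matrix to which f is applied is, up to unitary similarity, a Gram matrix
   T T^H with T = H W, where H is the square root of M = Psi(B^q) and
   W W^H = Phi(A^p); by Kraus' theorem one can take W = K^H A^(p/2), after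
   tensoring A with an identity matrix. In part (2), K = 1 and M is the inverse
   of Psi(B^(-q)).

   Let X = T T^H be built from a convex combination (A, B) of (A_1, B_1) and
   (A_2, B_2), let S >= 0 be the subgradient of f at X, and choose J such that
   J A^(2-p) J^H = S and e := Tr(J A^(1-p/2) T^H T A^(1-p/2) J^H) = Tr(S X). For
   fixed J the quantity e is jointly convex in (A, B), because T A^(1-p/2) =
   H K^H A, (x, D) |-> x Psi(D^(-1)) x^H is jointly convex and the power -q is
   operator concave. Rotating T_i T_i^H by a unitary matrix gives U_i such that
   Tr g(U_i) = Tr f(T_i T_i^H) and e_i <= Tr(J A_i^(2-p) J^H U_i^(p-1)). Lieb's
   concavity theorem, whose exponents 2-p and p-1 add up to 1, then yields
   Tr(S X) <= Tr(S U^(p-1)) for the convex combination U of U_1 and U_2, so that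
   Tr f(X) <= Tr f(U^(p-1)) = Tr g(U), and Peierls' inequality bounds Tr g(U) by
   the combination of the Tr g(U_i). *)
Require Import Defs.
From HB Require Import structures.
From mathcomp Require Import all_boot all_order all_fingroup all_algebra.
From mathcomp Require Import sesquilinear spectral.
From mathcomp Require Import complex.
From mathcomp Require Import boolp classical_sets interval_inference reals.
From mathcomp Require Import topology normedtype sequences exp convex hoelder.
From mathcomp Require Import ring lra.
From mathcomp Require mxtens.
Set Implicit Arguments. Unset Strict Implicit.
Unset Printing Implicit Defensive.
Import Order.TTheory GRing.Theory Num.Theory.
Import numFieldNormedType.Exports.
Local Open Scope ring_scope.
Local Open Scope sesquilinear_scope.

(* Elaborating every matrix operation through this one structure keeps the ring
   operations on complex matrices syntactically equal; on the bare type [R[i]],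
   unification would have to compare distinct paths through the hierarchy. *)
Definition complexType (R : realType) : numClosedFieldType := R[i].

Definition realC (R : realType) (x : R) : complexType R := rC x.

HB.instance Definition _ (R : realType) :=
  GRing.RMorphism.copy (@realC R) (real_complex R).

Section RealScalars.
Variable R : realType.
Local Notation C := (complexType R).

Lemma ler_realC (x y : R) : (realC x <= realC y) = (x <= y).
Proof. exact: lecR. Qed.

Lemma realC_ge0 (x : R) : (0 <= realC x) = (0 <= x).
Proof. exact: ler0c. Qed.

Lemma realC_gt0 (x : R) : (0 < realC x) = (0 < x).
Proof. exact: ltcR. Qed.

Lemma realCD (x y : R) : realC (x + y) = realC x + realC y.
Proof. exact: rmorphD. Qed.

Lemma realCM (x y : R) : realC (x * y) = realC x * realC y.
Proof. exact: rmorphM. Qed.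

Lemma realC_inj : injective (@realC R).
Proof. exact: complexI. Qed.

Lemma conj_realC (x : R) : (realC x)^* = realC x.
Proof. exact: conjc_real. Qed.

Lemma realC_Re (z : C) : z \is Num.real -> realC (complex.Re z) = z.
Proof. exact: RRe_real. Qed.

Lemma ler_cvx_realC (t : R) (x1 x2 y1 y2 : C) :
  0 <= t <= 1 -> x1 <= y1 -> x2 <= y2 ->
  realC t * x1 + realC (1 - t) * x2 <= realC t * y1 + realC (1 - t) * y2.
Proof.
move=> /andP[t_ge0 t_le1] le1 le2.
by apply: lerD; apply: ler_wpM2l; rewrite // realC_ge0 ?subr_ge0.
Qed.

End RealScalars.

Lemma mulmx1_invmx (F : comUnitRingType) n (A B : 'M[F]_n) :
  A *m B = 1%:M -> invmx A = B.
Proof.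
move=> AB1; have [unitA _] := mulmx1_unit AB1.
by rewrite -[RHS](mulKmx unitA) AB1 mulmx1.
Qed.

Section ConjugateTranspose.
Variable C : numClosedFieldType.

Lemma trmxCM m n p (A : 'M[C]_(m, n)) (B : 'M[C]_(n, p)) :
  (A *m B)^t* = B^t* *m A^t*.
Proof. by rewrite trmx_mul map_mxM. Qed.

Lemma trmxCD m n (A B : 'M[C]_(m, n)) : (A + B)^t* = A^t* + B^t*.
Proof. by rewrite linearD map_mxD. Qed.

Lemma trmxCN m n (A : 'M[C]_(m, n)) : (- A)^t* = - A^t*.
Proof. by rewrite linearN map_mxN. Qed.

Lemma trmxCB m n (A B : 'M[C]_(m, n)) : (A - B)^t* = A^t* - B^t*.
Proof. by rewrite trmxCD trmxCN. Qed.

Lemma trmxC_col_mx m1 m2 n (A : 'M[C]_(m1, n)) (B : 'M[C]_(m2, n)) :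
  (col_mx A B)^t* = row_mx (A^t*) (B^t*).
Proof. by rewrite tr_col_mx map_row_mx. Qed.

Lemma trmxC_row_mx m n1 n2 (A : 'M[C]_(m, n1)) (B : 'M[C]_(m, n2)) :
  (row_mx A B)^t* = col_mx (A^t*) (B^t*).
Proof. by rewrite tr_row_mx map_col_mx. Qed.

Lemma trmxC0 m n : (0 : 'M[C]_(m, n))^t* = 0.
Proof. by rewrite trmx0 map_mx0. Qed.

Lemma trmxC1 n : (1%:M : 'M[C]_n)^t* = 1%:M.
Proof. by rewrite trmx1 map_mx1. Qed.

Lemma trmxC_inv n (A : 'M[C]_n) : (invmx A)^t* = invmx (A^t*).
Proof. by rewrite trmx_inv map_invmx. Qed.

Lemma hermsymmxP n (A : 'M[C]_n) : reflect (A^t* = A) (A \is hermsymmx).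
Proof. by rewrite is_hermitianmxE expr0 scale1r eq_sym; exact: eqP. Qed.

Lemma hermsymmxE n (A : 'M[C]_n) : A \is hermsymmx -> A^t* = A.
Proof. by move/hermsymmxP. Qed.

Lemma herm_gram m n (T : 'M[C]_(m, n)) : T *m T^t* \is hermsymmx.
Proof. by apply/hermsymmxP; rewrite trmxCM trmxCK. Qed.

End ConjugateTranspose.

Local Notation "''[' u , v ]_ A" := (form Num.conj A u v)
  (at level 0, A at level 2, format "''[' u ,  v ]_ A").
Local Notation "''[' u ]_ A" := (form Num.conj A u u)
  (at level 0, A at level 2, format "''[' u ]_ A").

Section Forms.
Variable C : numClosedFieldType.

Lemma form_mxD n (A B : 'M[C]_n) u v : '[u, v]_(A + B) = '[u, v]_A + '[u, v]_B.
Proof. by rewrite /form mulmxDr mulmxDl mxE. Qed.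

Lemma form_mxB n (A B : 'M[C]_n) u v : '[u, v]_(A - B) = '[u, v]_A - '[u, v]_B.
Proof. by rewrite /form mulmxBr mulmxBl !mxE. Qed.

Lemma form_mxZ n (A : 'M[C]_n) a u v : '[u, v]_(a *: A) = a * '[u, v]_A.
Proof. by rewrite /form -scalemxAr -scalemxAl mxE. Qed.

Lemma form_mx_sum n (I : finType) (A : I -> 'M[C]_n) u v :
  '[u, v]_(\sum_i A i) = \sum_i '[u, v]_(A i).
Proof. by rewrite /form mulmx_sumr mulmx_suml summxE. Qed.

Lemma form_congr m n (T : 'M[C]_(m, n)) A u v :
  '[u, v]_(T *m A *m T^t*) = '[u *m T, v *m T]_A.
Proof. by rewrite /form [in RHS]trmxCM !mulmxA. Qed.

(* By polarization with the coefficients [1] and ['i]. *)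
Lemma form_real_herm n (A : 'M[C]_n) :
  (forall u, '[u]_A \is Num.real) -> A \is hermsymmx.
Proof.
move=> realA; apply/hermsymmxP/matrixP => i j; rewrite !mxE -!(formee Num.conj).
move: ('e_j) ('e_i) => u v.
have polar a : a * '[u, v]_A + a^* * '[v, u]_A \is Num.real.
  rewrite (_ : _ + _ = '[a *: u + v]_A - ('[a *: u]_A + '[v]_A)).
    by rewrite rpredB ?rpredD.
  by rewrite formDl !formDr !formZl !formZr /=; ring.
have /CrealP := polar 'i; have /CrealP := polar 1.
rewrite !(rmorphD, rmorphM) /= !(rmorph1, conjCi, rmorphN) /= !mul1r conjCi.
set a := '[u, v]_A; set b := '[v, u]_A => sum_real diff_real.
have nz2i : 2 * 'i != 0 :> C by rewrite mulf_neq0 ?neq0Ci ?pnatr_eq0.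
apply: (mulfI nz2i).
transitivity ('i * (a^* + b^*) - (- 'i * a^* + - - 'i * b^*)); first by ring.
by rewrite sum_real diff_real; ring.
Qed.

End Forms.

Section Positivity.
Variable R : realType.
Local Notation C := (complexType R).

Lemma possemidefP n (A : 'M[C]_n) : possemidef A <-> forall v, 0 <= '[v]_A.
Proof.
split=> [[_ posA] // | posA]; split=> //.
by apply: form_real_herm => u; exact: ger0_real.
Qed.

Lemma posdefP n (A : 'M[C]_n) : posdef A <-> forall v, v != 0 -> 0 < '[v]_A.
Proof.
split=> [[_ posA] // | posA]; split=> //; apply: form_real_herm => u.
have [->|/posA/gtr0_real //] := eqVneq u 0; by rewrite form0l real0.
Qed.

Lemma posdef_herm n (A : 'M[C]_n) : posdef A -> A \is hermsymmx.
Proof. by case. Qed.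

Lemma possemidef_herm n (A : 'M[C]_n) : possemidef A -> A \is hermsymmx.
Proof. by case. Qed.

Lemma posdef_possemidef n (A : 'M[C]_n) : posdef A -> possemidef A.
Proof.
move=> /posdefP posA; apply/possemidefP => v.
by have [->|/posA/ltW //] := eqVneq v 0; rewrite form0l.
Qed.

Lemma possemidefD n (A B : 'M[C]_n) :
  possemidef A -> possemidef B -> possemidef (A + B).
Proof.
move=> /possemidefP posA /possemidefP posB; apply/possemidefP => v.
by rewrite form_mxD addr_ge0.
Qed.

Lemma possemidefZ n (a : C) (A : 'M[C]_n) :
  0 <= a -> possemidef A -> possemidef (a *: A).
Proof.
move=> a_ge0 /possemidefP posA; apply/possemidefP => v.
by rewrite form_mxZ mulr_ge0.
Qed.

Lemma posdefDl n (A B : 'M[C]_n) : possemidef A -> posdef B -> posdef (A + B).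
Proof.
move=> /possemidefP posA /posdefP posB; apply/posdefP => v v_neq0.
by rewrite form_mxD ltr_wpDl ?posB.
Qed.

Lemma posdefZ n (a : C) (A : 'M[C]_n) : 0 < a -> posdef A -> posdef (a *: A).
Proof.
move=> a_gt0 /posdefP posA; apply/posdefP => v v_neq0.
by rewrite form_mxZ mulr_gt0 ?posA.
Qed.

Lemma possemidef_congr m n (T : 'M[C]_(m, n)) A :
  possemidef A -> possemidef (T *m A *m T^t*).
Proof.
by move=> /possemidefP posA; apply/possemidefP => v; rewrite form_congr.
Qed.

Lemma posdef_congr m n (T : 'M[C]_(m, n)) A :
  row_free T -> posdef A -> posdef (T *m A *m T^t*).
Proof.
move=> freeT /posdefP posA; apply/posdefP => v v_neq0.
by rewrite form_congr posA ?mulmx_free_eq0.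
Qed.

Lemma posdef1 n : posdef (1%:M : 'M[C]_n).
Proof. by apply/posdefP => v; rewrite /form mulmx1 -dotmxE dnorm_gt0. Qed.

Lemma possemidef_gram m n (T : 'M[C]_(m, n)) : possemidef (T *m T^t*).
Proof.
rewrite -[T in T *m _]mulmx1.
exact/possemidef_congr/posdef_possemidef/posdef1.
Qed.

Lemma posdef_unit n (A : 'M[C]_n) : posdef A -> A \in unitmx.
Proof.
move=> /posdefP posA; rewrite -row_free_unit -kermx_eq0.
apply/rowV0P => v /sub_kermxP vA0; apply/eqP/negPn/negP => /posA.
by rewrite /form vA0 mul0mx mxE ltxx.
Qed.

Lemma row_free_gram m n (T : 'M[C]_(m, n)) : posdef (T *m T^t*) -> row_free T.
Proof.
move=> /posdef_unit unitTT; apply/row_freeP; exists (T^t* *m invmx (T *m T^t*)).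
by rewrite mulmxA mulmxV.
Qed.

Lemma posdef_inv n (A : 'M[C]_n) : posdef A -> posdef (invmx A).
Proof.
move=> posA; have unitA := posdef_unit posA.
have := posdef_congr (T := invmx A) _ posA.
rewrite row_free_unit unitmx_inv => /(_ unitA).
by rewrite trmxC_inv (hermsymmxE (posdef_herm posA)) mulVmx ?mul1mx.
Qed.

Lemma mxtrace_congr m n (T : 'M[C]_(m, n)) A :
  \tr (T *m A *m T^t*) = \sum_i '[row i T]_A.
Proof.
apply: eq_bigr => i _; rewrite -(formee Num.conj) form_congr.
by rewrite -!rowE.
Qed.

Definition lemx n (A B : 'M[C]_n) := possemidef (B - A).

Lemma lemxP n (A B : 'M[C]_n) : lemx A B <-> forall v, '[v]_A <= '[v]_B.
Proof.
split=> [/possemidefP leAB v|leAB]; first by rewrite -subr_ge0 -form_mxB.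
by apply/possemidefP => v; rewrite form_mxB subr_ge0.
Qed.

Lemma lemxx n (A : 'M[C]_n) : lemx A A.
Proof. by apply/lemxP. Qed.

Lemma lemx_congr m n (T : 'M[C]_(m, n)) A B :
  lemx A B -> lemx (T *m A *m T^t*) (T *m B *m T^t*).
Proof. by rewrite /lemx -mulmxBl -mulmxBr; exact: possemidef_congr. Qed.

Lemma lemx_inv n (A B : 'M[C]_n) :
  posdef A -> posdef B -> lemx A B -> lemx (invmx B) (invmx A).
Proof.
move=> posA posB leAB.
have [unitA unitB] := (posdef_unit posA, posdef_unit posB).
have [hA hB] := (hermsymmxE (posdef_herm posA), hermsymmxE (posdef_herm posB)).
rewrite /lemx; suff -> : invmx A - invmx B =
    (invmx A - invmx B) *m A *m (invmx A - invmx B)^t*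
    + invmx B *m (B - A) *m (invmx B)^t*.
  apply: possemidefD; apply: possemidef_congr => //.
  exact: posdef_possemidef.
rewrite trmxCB !trmxC_inv hA hB !(mulmxBl, mulmxBr) !mulVmx //.
rewrite !mul1mx mulmxK //.
by rewrite subrK.
Qed.

Definition cvx m n (t : R) (A B : 'M[C]_(m, n)) : 'M[C]_(m, n) :=
  realC t *: A + realC (1 - t) *: B.

Lemma cvx_mulmxl m n p t (A B : 'M[C]_(m, n)) (D : 'M[C]_(n, p)) :
  cvx t A B *m D = cvx t (A *m D) (B *m D).
Proof. by rewrite /cvx mulmxDl -!scalemxAl. Qed.

Lemma cvx_mulmxr m n p t (A B : 'M[C]_(n, p)) (D : 'M[C]_(m, n)) :
  D *m cvx t A B = cvx t (D *m A) (D *m B).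
Proof. by rewrite /cvx mulmxDr -!scalemxAr. Qed.

Lemma cvxBr m n t (A B D : 'M[C]_(m, n)) :
  cvx t (A - D) (B - D) = cvx t A B - D.
Proof.
rewrite /cvx !scalerBr addrACA -opprD -scalerDl -realCD subrKC rmorph1.
by rewrite scale1r.
Qed.

Lemma linear_cvx m n p q (f : {linear 'M[C]_(m, n) -> 'M[C]_(p, q)}) t A B :
  f (cvx t A B) = cvx t (f A) (f B).
Proof. by rewrite linearD !linearZ. Qed.

Lemma form_cvx n t (A B : 'M[C]_n) u v :
  '[u, v]_(cvx t A B) = realC t * '[u, v]_A + realC (1 - t) * '[u, v]_B.
Proof. by rewrite form_mxD !form_mxZ. Qed.

Lemma mxtrace_cvx n t (A B : 'M[C]_n) :
  \tr (cvx t A B) = realC t * \tr A + realC (1 - t) * \tr B.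
Proof. by rewrite mxtraceD !mxtraceZ. Qed.

Lemma cvx_possemidef n t (A B : 'M[C]_n) :
  0 <= t <= 1 -> possemidef A -> possemidef B -> possemidef (cvx t A B).
Proof.
move=> /andP[t_ge0 t_le1] posA posB.
by apply: possemidefD; apply: possemidefZ; rewrite ?realC_ge0 ?subr_ge0.
Qed.

Lemma cvx_posdef n t (A B : 'M[C]_n) :
  0 <= t <= 1 -> posdef A -> posdef B -> posdef (cvx t A B).
Proof.
move=> /andP[t_ge0 t_le1] posA posB; have [->|t_neq1] := eqVneq t 1.
  by rewrite /cvx subrr rmorph1 rmorph0 scale1r scale0r addr0.
apply: posdefDl.
  by apply: possemidefZ; [rewrite realC_ge0 | exact: posdef_possemidef].
by apply: posdefZ; rewrite // realC_gt0 subr_gt0 lt_neqAle t_neq1.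
Qed.

End Positivity.

Section FunctionalCalculus.
Variable R : realType.
Local Notation C := (complexType R).

Definition rdiag n (e : 'I_n -> R) : 'M[C]_n := diag_mx (\row_i realC (e i)).

Lemma mul_rdiag_mx m n (e : 'I_m -> R) (A : 'M[C]_(m, n)) i j :
  (rdiag e *m A) i j = realC (e i) * A i j.
Proof. by rewrite mul_diag_mx !mxE. Qed.

Lemma mul_mx_rdiag m n (e : 'I_n -> R) (A : 'M[C]_(m, n)) i j :
  (A *m rdiag e) i j = A i j * realC (e j).
Proof. by rewrite mul_mx_diag !mxE. Qed.

Lemma eq_rdiag n (d e : 'I_n -> R) : d =1 e -> rdiag d = rdiag e.
Proof. by move=> de; congr diag_mx; apply/rowP => i; rewrite !mxE de. Qed.

Lemma rdiagM n (d e : 'I_n -> R) :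
  rdiag d *m rdiag e = rdiag (fun i => d i * e i).
Proof.
by rewrite mulmx_diag; congr diag_mx; apply/rowP => i; rewrite !mxE realCM.
Qed.

Lemma rdiag1 n : rdiag (fun _ : 'I_n => 1) = 1%:M.
Proof. by apply/matrixP => i j; rewrite !mxE. Qed.

Lemma rdiag_herm n (e : 'I_n -> R) : rdiag e \is hermsymmx.
Proof.
apply/hermsymmxP; rewrite tr_diag_mx map_diag_mx; congr diag_mx.
by apply/rowP => i; rewrite !mxE; exact: conj_realC.
Qed.

Lemma form_rdiag n (v : 'rV[C]_n) e :
  '[v]_(rdiag e) = \sum_i realC (e i) * `|v 0 i| ^+ 2.
Proof.
rewrite /form mxE; apply: eq_bigr => i _.
by rewrite mul_mx_rdiag !mxE normCK mulrAC mulrC.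
Qed.

Lemma possemidef_rdiag n (e : 'I_n -> R) :
  possemidef (rdiag e) <-> forall i, 0 <= e i.
Proof.
split=> [/possemidefP pos_e i | e_ge0].
  by have := pos_e 'e_i; rewrite formee !mxE eqxx mulr1n realC_ge0.
apply/possemidefP => v; rewrite form_rdiag sumr_ge0 // => i _.
by rewrite mulr_ge0 ?realC_ge0 ?exprn_ge0.
Qed.

Lemma posdef_rdiag n (e : 'I_n -> R) :
  posdef (rdiag e) <-> forall i, 0 < e i.
Proof.
split=> [/posdefP pos_e i | e_gt0].
  have := pos_e 'e_i; rewrite formee !mxE eqxx mulr1n realC_gt0; apply.
  by apply/rV0Pn; exists i; rewrite mxE !eqxx oner_eq0.
apply/posdefP => v /rV0Pn[i vi_neq0]; rewrite form_rdiag (bigD1 i) //=.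
apply: ltr_pwDl; first by rewrite mulr_gt0 ?realC_gt0 ?exprn_gt0 ?normr_gt0.
by apply: sumr_ge0 => j _; rewrite mulr_ge0 ?realC_ge0 ?exprn_ge0 // ltW.
Qed.

Definition diagonalizes n (P : 'M[C]_n) (e : 'I_n -> R) (A : 'M[C]_n) : Prop :=
  P \is unitarymx /\ A = P^t* *m rdiag e *m P.

Lemma unitarymx_row_free n (P : 'M[C]_n) : P \is unitarymx -> row_free P.
Proof. by move=> /unitarymx_unit; rewrite row_free_unit. Qed.

Lemma unitarymxV n (P : 'M[C]_n) : P \is unitarymx -> P^t* *m P = 1%:M.
Proof. by move=> /unitarymxP/mulmx1C. Qed.

Lemma diagonalizes_rdiag n P e (A : 'M[C]_n) :
  diagonalizes P e A -> rdiag e = P *m A *m P^t*.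
Proof.
case=> unitP ->; rewrite !mulmxA (unitarymxP unitP) mul1mx.
by rewrite mulmxtVK.
Qed.

Lemma diagonalizes_herm n P e (A : 'M[C]_n) :
  diagonalizes P e A -> A \is hermsymmx.
Proof.
case=> _ ->; apply/hermsymmxP.
by rewrite !trmxCM trmxCK (hermsymmxE (rdiag_herm e)) mulmxA.
Qed.

Lemma possemidef_diag n P e (A : 'M[C]_n) :
  diagonalizes P e A -> possemidef A <-> forall i, 0 <= e i.
Proof.
move=> diagA; rewrite -possemidef_rdiag; split.
  by rewrite (diagonalizes_rdiag diagA); exact: possemidef_congr.
by case: diagA => _ ->; rewrite -{2}[P]trmxCK; exact: possemidef_congr.
Qed.

Lemma posdef_diag n P e (A : 'M[C]_n) :
  diagonalizes P e A -> posdef A <-> forall i, 0 < e i.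
Proof.
move=> diagA; rewrite -posdef_rdiag; have [unitP defA] := diagA; split.
  rewrite (diagonalizes_rdiag diagA); apply: posdef_congr.
  exact: unitarymx_row_free.
rewrite defA -{2}[P]trmxCK; apply: posdef_congr.
by rewrite unitarymx_row_free ?trmxC_unitary.
Qed.

Lemma diagonalizes_unitary n P e (A O : 'M[C]_n) :
  O \is unitarymx -> diagonalizes P e A ->
  diagonalizes (P *m O) e (O^t* *m A *m O).
Proof.
by move=> unitO [unitP ->]; split; rewrite ?mul_unitarymx // trmxCM !mulmxA.
Qed.

Lemma hermsymmx_diagonalizes n (A : 'M[C]_n) : A \is hermsymmx ->
  diagonalizes (spectralmx A) (fun i => complex.Re (spectral_diag A 0 i)) A.
Proof.
move=> hA; have unitP := spectral_unitarymx A; split=> //.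
have /orthomx_spectralP {1}-> := hermitian_normalmx hA.
rewrite (invmx_unitary unitP).
suff -> : rdiag (fun i => complex.Re (spectral_diag A 0 i)) =
  diag_mx (spectral_diag A) by [].
congr diag_mx; apply/rowP => i; rewrite mxE realC_Re //.
by have /mxOverP := hermitian_spectral_diag_real hA.
Qed.

Lemma hermsymmx_spectral n (A : 'M[C]_n) :
  A \is hermsymmx -> exists P e, diagonalizes P e A.
Proof. by move=> /hermsymmx_diagonalizes diagA; do 2!eexists; exact: diagA. Qed.

Lemma posdef_spectral n (A : 'M[C]_n) :
  posdef A -> exists P e, diagonalizes P e A /\ forall i, 0 < e i.
Proof.
move=> posA; have [P [e diagA]] := hermsymmx_spectral (posdef_herm posA).
by exists P, e; split=> //; apply/(posdef_diag diagA).
Qed.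

Lemma rdiag_intertwine m n d e (T : 'M[C]_(m, n)) (f : R -> R) :
  T *m rdiag d = rdiag e *m T -> T *m rdiag (f \o d) = rdiag (f \o e) *m T.
Proof.
move=> /matrixP comm; apply/matrixP => i j; move: (comm i j).
rewrite !mul_mx_rdiag !mul_rdiag_mx ![T i j * _]mulrC /=.
have [-> | Tij_neq0] := eqVneq (T i j) 0; first by rewrite !mulr0.
by move=> /(mulIf Tij_neq0)/realC_inj ->.
Qed.

Lemma diagonalizes_intertwine m n P d Q e (A : 'M[C]_n) (B : 'M[C]_m)
    (T : 'M[C]_(m, n)) (f : R -> R) :
  diagonalizes P d A -> diagonalizes Q e B -> T *m A = B *m T ->
  T *m (P^t* *m rdiag (f \o d) *m P) = Q^t* *m rdiag (f \o e) *m Q *m T.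
Proof.
move=> [unitP ->] [unitQ ->] comm.
have /(rdiag_intertwine f) :
    Q *m T *m P^t* *m rdiag d = rdiag e *m (Q *m T *m P^t*).
  move/(congr1 (fun X => Q *m X *m P^t*)): comm.
  by rewrite !mulmxA (mulmxtVK _ unitP) (unitarymxP unitQ) mul1mx.
move/(congr1 (fun X => Q^t* *m X *m P)).
by rewrite !mulmxA (unitarymxV unitQ) mul1mx (mulmxKtV _ unitP erefl).
Qed.

Lemma mxfun_spectral n (A : 'M[C]_n) f : mxfun f A = (spectralmx A)^t* *m
  rdiag (fun i => f (complex.Re (spectral_diag A 0 i))) *m spectralmx A.
Proof.
rewrite /mxfun (invmx_unitary (spectral_unitarymx A)).
suff -> : map_mx (fun z => rC (f (complex.Re z))) (spectral_diag A) =
  \row_i realC (f (complex.Re (spectral_diag A 0 i))) by [].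
by apply/rowP => i; rewrite !mxE.
Qed.

Lemma mxfun_diag n P e (A : 'M[C]_n) f :
  diagonalizes P e A -> mxfun f A = P^t* *m rdiag (f \o e) *m P.
Proof.
move=> diagA; have diagA' := hermsymmx_diagonalizes (diagonalizes_herm diagA).
have := diagonalizes_intertwine (T := 1%:M) f diagA' diagA.
by rewrite mulmx1 mul1mx mxfun_spectral => /(_ erefl); rewrite mul1mx mulmx1.
Qed.

Lemma diagonalizes_mxfun n P e (A : 'M[C]_n) (f : R -> R) :
  diagonalizes P e A -> diagonalizes P (f \o e) (mxfun f A).
Proof. by move=> diagA; split; [case: diagA | exact: mxfun_diag]. Qed.

Lemma mxfun_intertwine m n (A : 'M[C]_n) (B : 'M[C]_m) (T : 'M[C]_(m, n)) f :
  A \is hermsymmx -> B \is hermsymmx -> T *m A = B *m T ->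
  T *m mxfun f A = mxfun f B *m T.
Proof.
move=> /hermsymmx_spectral[P [d diagA]] /hermsymmx_spectral[Q [e diagB]] comm.
rewrite (mxfun_diag _ diagA) (mxfun_diag _ diagB).
exact: diagonalizes_intertwine diagA diagB comm.
Qed.

Lemma mxfun_herm n (A : 'M[C]_n) f : A \is hermsymmx -> mxfun f A \is hermsymmx.
Proof.
move=> /hermsymmx_spectral[P [e diagA]].
exact: diagonalizes_herm (diagonalizes_mxfun f diagA).
Qed.

Lemma mxfunM n (A : 'M[C]_n) f g : A \is hermsymmx ->
  mxfun f A *m mxfun g A = mxfun (fun x => f x * g x) A.
Proof.
move=> /hermsymmx_spectral[P [e diagA]]; rewrite !(mxfun_diag _ diagA).
case: diagA => unitP _; rewrite !mulmxA (mulmxtVK _ unitP).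
by rewrite -(mulmxA (P^t*) (rdiag _) (rdiag _)) rdiagM.
Qed.

Lemma mxfun_comp n (A : 'M[C]_n) f g : A \is hermsymmx ->
  mxfun g (mxfun f A) = mxfun (g \o f) A.
Proof.
move=> /hermsymmx_spectral[P [e diagA]].
by rewrite (mxfun_diag _ (diagonalizes_mxfun f diagA)) (mxfun_diag _ diagA).
Qed.

Lemma mxfun_id n (A : 'M[C]_n) : A \is hermsymmx -> mxfun id A = A.
Proof.
move=> /hermsymmx_spectral[P [e diagA]].
by rewrite (mxfun_diag _ diagA) [RHS](proj2 diagA).
Qed.

Lemma mxfun1 n (A : 'M[C]_n) : A \is hermsymmx -> mxfun (fun=> 1) A = 1%:M.
Proof.
move=> /hermsymmx_spectral[P [e diagA]]; rewrite (mxfun_diag _ diagA).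
by case: diagA => unitP _; rewrite [rdiag _]rdiag1 mulmx1 unitarymxV.
Qed.

Lemma eq_mxfun_posdef n (A : 'M[C]_n) f g : posdef A ->
  (forall x, 0 < x -> f x = g x) -> mxfun f A = mxfun g A.
Proof.
move=> /posdef_spectral[P [e [diagA e_gt0]]] fg; rewrite !(mxfun_diag _ diagA).
by have -> : rdiag (f \o e) = rdiag (g \o e) by apply: eq_rdiag => i; exact: fg.
Qed.

Lemma mxfun_posdef n (A : 'M[C]_n) f : posdef A ->
  (forall x, 0 < x -> 0 < f x) -> posdef (mxfun f A).
Proof.
move=> /posdef_spectral[P [e [diagA e_gt0]]] f_gt0.
by apply/(posdef_diag (diagonalizes_mxfun f diagA)) => i; apply: f_gt0.
Qed.

Lemma mxfun_possemidef n (A : 'M[C]_n) f : posdef A ->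
  (forall x, 0 < x -> 0 <= f x) -> possemidef (mxfun f A).
Proof.
move=> /posdef_spectral[P [e [diagA e_gt0]]] f_ge0.
by apply/(possemidef_diag (diagonalizes_mxfun f diagA)) => i; apply: f_ge0.
Qed.

Lemma possemidef_sqrt n (A : 'M[C]_n) : possemidef A ->
  exists2 S, S \is hermsymmx & S *m S = A.
Proof.
move=> posA; have hA := possemidef_herm posA.
have [P [e diagA]] := hermsymmx_spectral hA.
exists (mxfun Num.sqrt A); first exact: mxfun_herm.
have e_ge0 : forall i, 0 <= e i by apply/(possemidef_diag diagA).
rewrite (mxfunM _ _ hA) -[RHS](mxfun_id hA) !(mxfun_diag _ diagA).
suff -> : rdiag ((fun x => Num.sqrt x * Num.sqrt x) \o e) = rdiag (id \o e).
  by [].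
by apply: eq_rdiag => i /=; rewrite -expr2 sqr_sqrtr.
Qed.

Lemma posdef_sqrt n (A : 'M[C]_n) : posdef A ->
  exists S, [/\ S \is hermsymmx, S \in unitmx & S *m S = A].
Proof.
move=> posA; have [S hS SS] := possemidef_sqrt (posdef_possemidef posA).
exists S; split=> //; move: (posdef_unit posA).
by rewrite -SS unitmx_mul => /andP[].
Qed.

Lemma mxtrace_mul_ge0 n (A B : 'M[C]_n) :
  possemidef A -> possemidef B -> 0 <= \tr (A *m B).
Proof.
move=> posA /possemidef_sqrt[S hS <-].
rewrite mulmxA mxtrace_mulC mulmxA -[X in _ *m X](hermsymmxE hS) mxtrace_congr.
by apply: sumr_ge0 => i _; have /possemidefP := posA.
Qed.

Lemma ler_mxtrace_mul n (A B W : 'M[C]_n) :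
  possemidef W -> lemx A B -> \tr (A *m W) <= \tr (B *m W).
Proof.
move=> posW leAB; rewrite -subr_ge0 -raddfB -mulmxBl.
exact: mxtrace_mul_ge0.
Qed.

End FunctionalCalculus.

Section TraceFunctions.
Variable R : realType.
Local Notation C := (complexType R).

Lemma trf_diag n P e (A : 'M[C]_n) f :
  diagonalizes P e A -> trf f A = \sum_i f (e i).
Proof.
move=> diagA; rewrite /trf (mxfun_diag _ diagA) mxtrace_mulC mulmxA.
rewrite (unitarymxP (proj1 diagA)) mul1mx mxtrace_diag.
by under eq_bigr do rewrite mxE; rewrite -rmorph_sum.
Qed.

Lemma mxtrace_mxfun n (A : 'M[C]_n) f :
  A \is hermsymmx -> \tr (mxfun f A) = realC (trf f A).
Proof.
move=> /hermsymmx_spectral[P [e diagA]]; rewrite (trf_diag _ diagA).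
rewrite (mxfun_diag _ diagA) mxtrace_mulC mulmxA.
rewrite (unitarymxP (proj1 diagA)) mul1mx mxtrace_diag rmorph_sum.
by apply: eq_bigr => i _; rewrite mxE.
Qed.

Lemma trf_mxfun n (A : 'M[C]_n) f g :
  A \is hermsymmx -> trf g (mxfun f A) = trf (g \o f) A.
Proof. by move=> hA; rewrite /trf mxfun_comp. Qed.

Lemma eq_trf_posdef n (A : 'M[C]_n) f g :
  posdef A -> (forall x, 0 < x -> f x = g x) -> trf f A = trf g A.
Proof. by move=> posA fg; rewrite /trf (eq_mxfun_posdef posA fg). Qed.

Lemma trf_unitary n (A O : 'M[C]_n) f : A \is hermsymmx -> O \is unitarymx ->
  trf f (O^t* *m A *m O) = trf f A.
Proof.
move=> /hermsymmx_spectral[P [e diagA]] unitO.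
by rewrite (trf_diag _ diagA) (trf_diag _ (diagonalizes_unitary unitO diagA)).
Qed.

(* Writing [f x = x * k x + f 0], the first term is handled by cyclicity because
   [T^t*] intertwines the two Gram matrices. *)
Lemma trf_gram n (T : 'M[C]_n) f : trf f (T *m T^t*) = trf f (T^t* *m T).
Proof.
have [hTT hTT'] : T *m T^t* \is hermsymmx /\ T^t* *m T \is hermsymmx.
  by split; [|rewrite -{2}[T]trmxCK]; exact: herm_gram.
pose k x := (f x - f 0) / x.
have fE (A : 'M[C]_n) : A \is hermsymmx ->
    realC (trf f A) = \tr (A *m mxfun k A) + realC (f 0) *+ n.
  move=> hA; have [P [e diagA]] := hermsymmx_spectral hA.
  rewrite -{2}(mxfun_id hA) (mxfunM _ _ hA) (mxtrace_mxfun _ hA).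
  rewrite !(trf_diag _ diagA).
  have -> : realC (f 0) *+ n = realC (\sum_(i < n) f 0).
    by rewrite sumr_const card_ord rmorphMn.
  rewrite -realCD -big_split; congr (realC _); apply: eq_bigr => i _.
  rewrite /k /=.
  have [->|x_neq0] := eqVneq (e i) 0; first by rewrite mul0r add0r.
  by rewrite mulrC divfK // subrK.
have comm : T^t* *m (T *m T^t*) = T^t* *m T *m T^t* by rewrite mulmxA.
apply: (@realC_inj R); rewrite [LHS](fE _ hTT) [RHS](fE _ hTT').
rewrite -(mulmxA T (T^t*)).
by rewrite (mxfun_intertwine k hTT hTT' comm) mulmxA mxtrace_mulC mulmxA.
Qed.

Lemma perm_mx_unitary n (s : 'S_n) : (perm_mx s : 'M[C]_n) \is unitarymx.
Proof.
by apply/unitarymxP; rewrite tr_perm_mx map_perm_mx -perm_mxM mulgV perm_mx1.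
Qed.

Lemma diagonalizes_perm n P e (A : 'M[C]_n) (s : 'S_n) :
  diagonalizes P (e \o s) A -> diagonalizes (perm_mx s^-1%g *m P) e A.
Proof.
case=> unitP ->; split; first by rewrite mul_unitarymx ?perm_mx_unitary.
suff -> : rdiag (e \o s) = perm_mx s *m rdiag e *m perm_mx s^-1%g.
  by rewrite trmxCM tr_perm_mx map_perm_mx invgK !mulmxA.
rewrite -col_permE -row_permE; apply/matrixP => i j; rewrite !mxE.
by rewrite (inj_eq perm_inj).
Qed.

Lemma trf_inj_unitary n (A B : 'M[C]_n) :
  A \is hermsymmx -> B \is hermsymmx -> (forall f, trf f A = trf f B) ->
  exists2 O, O \is unitarymx & B = O^t* *m A *m O.
Proof.
move=> /hermsymmx_spectral[P [d diagA]] /hermsymmx_spectral[Q [e diagB]] trAB.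
have count_tuple (h : 'I_n -> R) x :
    count_mem x [tuple h i | i < n] = (\sum_(i < n) (h i == x))%N.
  by rewrite -sum1_count big_mkcond big_map big_enum.
have /tuple_permP[s /val_inj eds] :
    perm_eq [tuple e i | i < n] [tuple d i | i < n].
  apply/allP => x _; rewrite /= !count_tuple -(eqr_nat R) !natr_sum eq_sym.
  have := trAB (fun y => (y == x)%:R).
  by rewrite (trf_diag _ diagA) (trf_diag _ diagB) => ->.
have e_perm : e =1 d \o s.
  by move=> i; have := congr1 (fun t => tnth t i) eds; rewrite !tnth_mktuple.
have {}diagB : diagonalizes Q (d \o s) B.
  by have [unitQ ->] := diagB; split; last rewrite (eq_rdiag e_perm).
have [unitQ' ->] := diagonalizes_perm diagB; have [unitP _] := diagA.
set Q' := perm_mx _ *m Q in unitQ' *.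
exists (P^t* *m Q'); first by rewrite mul_unitarymx ?trmxC_unitary.
by rewrite (diagonalizes_rdiag diagA) (trmxCM (P^t*)) trmxCK !mulmxA.
Qed.

Lemma gram_unitary_similar n (T : 'M[C]_n) :
  exists2 O, O \is unitarymx & T^t* *m T = O^t* *m (T *m T^t*) *m O.
Proof.
apply: trf_inj_unitary; last exact: trf_gram; first exact: herm_gram.
by rewrite -{2}[T]trmxCK herm_gram.
Qed.

Lemma unitary_sum_row n (O : 'M[C]_n) i :
  O \is unitarymx -> \sum_j `|O i j| ^+ 2 = 1.
Proof.
move=> unitO; transitivity ((O *m O^t*) i i).
  by rewrite mxE; apply: eq_bigr => j _; rewrite !mxE normCK.
by rewrite (unitarymxP unitO) mxE eqxx.
Qed.

Lemma unitary_sum_col n (O : 'M[C]_n) j :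
  O \is unitarymx -> \sum_i `|O i j| ^+ 2 = 1.
Proof.
move=> unitO; transitivity ((O^t* *m O) j j).
  by rewrite mxE; apply: eq_bigr => i _; rewrite !mxE normCK mulrC.
by rewrite (unitarymxV unitO) mxE eqxx.
Qed.

Lemma mxtrace_rdiag_unitary n (a b : 'I_n -> R) (O : 'M[C]_n) :
  \tr (rdiag a *m O *m rdiag b *m O^t*) =
  \sum_i \sum_j realC (a i * b j) * `|O i j| ^+ 2.
Proof.
apply: eq_bigr => i _; rewrite mxE; apply: eq_bigr => j _.
by rewrite mul_mx_rdiag mul_rdiag_mx !mxE /= normCK realCM; ring.
Qed.

(* The squared moduli of the entries of the unitary matrix relating the two
   eigenbases are doubly stochastic weights. *)
Lemma trf_gradient n (X Y : 'M[C]_n) P x Q y (f c : R -> R) :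
  diagonalizes P x X -> diagonalizes Q y Y ->
  (forall i j, f (x i) + c (x i) * (y j - x i) <= f (y j)) ->
  realC (trf f X) + \tr (mxfun c X *m (Y - X)) <= realC (trf f Y).
Proof.
move=> diagX diagY grad; have hX := diagonalizes_herm diagX.
have [[unitP _] [unitQ defY]] := (diagX, diagY).
pose O := P *m Q^t*; have unitO : O \is unitarymx.
  by rewrite mul_unitarymx ?trmxC_unitary.
have row_average (h : 'I_n -> R) :
    \sum_i realC (h i) = \sum_i \sum_j realC (h i) * `|O i j| ^+ 2.
  by apply: eq_bigr => i _; rewrite -mulr_sumr unitary_sum_row ?mulr1.
have col_average (h : 'I_n -> R) :
    \sum_j realC (h j) = \sum_i \sum_j realC (h j) * `|O i j| ^+ 2.
  rewrite exchange_big; apply: eq_bigr => j _.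
  by rewrite -mulr_sumr unitary_sum_col ?mulr1.
have trXY : \tr (mxfun c X *m Y) =
    \sum_i \sum_j realC (c (x i) * y j) * `|O i j| ^+ 2.
  transitivity (\tr (P^t* *m (rdiag (c \o x) *m O *m rdiag y *m Q))).
    by rewrite (mxfun_diag _ diagX) defY /O !mulmxA.
  rewrite mxtrace_mulC -(mulmxA _ Q) (_ : Q *m P^t* = O^t*).
    exact: mxtrace_rdiag_unitary.
  by rewrite trmxCM trmxCK.
have trX : \tr (mxfun c X *m X) = \sum_i realC (c (x i) * x i).
  rewrite -{2}(mxfun_id hX) (mxfunM _ _ hX) (mxtrace_mxfun _ hX).
  by rewrite (trf_diag _ diagX) rmorph_sum.
rewrite mulmxBr raddfB /= trXY trX (trf_diag _ diagX) (trf_diag _ diagY).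
rewrite !rmorph_sum /= (row_average (f \o x)) (col_average (f \o y)).
rewrite (row_average (fun i => c (x i) * x i)) -sumrB -big_split.
apply: ler_sum => i _; rewrite -sumrB -big_split; apply: ler_sum => j _ /=.
rewrite -mulrBl -mulrDl ler_wpM2r ?exprn_ge0 // -rmorphB -realCD ler_realC.
by have := grad i j; rewrite mulrBr.
Qed.

Definition subgradient_pos (f c : R -> R) : Prop :=
  forall x y, 0 < x -> 0 < y -> f x + c x * (y - x) <= f y.

Lemma trf_gradient_posdef n (X Y : 'M[C]_n) (f c : R -> R) :
  posdef X -> posdef Y ->
  subgradient_pos f c ->
  realC (trf f X) + \tr (mxfun c X *m (Y - X)) <= realC (trf f Y).
Proof.
move=> /posdef_spectral[P [x [diagX x_gt0]]].
move=> /posdef_spectral[Q [y [diagY y_gt0]]] grad.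
by apply: (trf_gradient diagX diagY) => i j; apply: grad.
Qed.

(* Peierls' inequality: both points are compared with their combination. *)
Lemma trf_convex n (X Y : 'M[C]_n) (f c : R -> R) (t : R) :
  0 <= t <= 1 -> posdef X -> posdef Y ->
  subgradient_pos f c ->
  trf f (cvx t X Y) <= t * trf f X + (1 - t) * trf f Y.
Proof.
move=> t01 posX posY grad; have posZ := cvx_posdef t01 posX posY.
have gradX := trf_gradient_posdef posZ posX grad.
have gradY := trf_gradient_posdef posZ posY grad.
set Z := cvx t X Y in posZ gradX gradY *.
have mean_zero : realC t * \tr (mxfun c Z *m (X - Z)) +
                 realC (1 - t) * \tr (mxfun c Z *m (Y - Z)) = 0.
  by rewrite -mxtrace_cvx -cvx_mulmxr cvxBr subrr mulmx0 mxtrace0.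
have decompose : realC (trf f Z) =
    realC t * (realC (trf f Z) + \tr (mxfun c Z *m (X - Z))) +
    realC (1 - t) * (realC (trf f Z) + \tr (mxfun c Z *m (Y - Z))).
  by rewrite !mulrDr addrACA mean_zero addr0 -mulrDl -realCD subrKC mul1r.
have realC_cvx a b :
    realC (t * a + (1 - t) * b) = realC t * realC a + realC (1 - t) * realC b.
  by rewrite realCD !realCM.
rewrite -ler_realC [leLHS]decompose [leRHS]realC_cvx.
exact: ler_cvx_realC t01 gradX gradY.
Qed.

End TraceFunctions.

Section Powers.
Variable R : realType.
Local Notation C := (complexType R).
Variables (n : nat) (A : 'M[C]_n).
Hypothesis posA : posdef A.

Lemma mxpow_posdef a : posdef (mxpow A a).
Proof. by apply: mxfun_posdef => // x x_gt0; exact: powR_gt0. Qed.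

Lemma mxpow_herm a : mxpow A a \is hermsymmx.
Proof. exact/posdef_herm/mxpow_posdef. Qed.

Lemma mxpowD a b : mxpow A (a + b) = mxpow A a *m mxpow A b.
Proof.
rewrite (mxfunM _ _ (posdef_herm posA)); apply: eq_mxfun_posdef => // x x_gt0.
by rewrite powRD // (gt_eqF x_gt0) implybT.
Qed.

Lemma mxpow0 : mxpow A 0 = 1%:M.
Proof.
rewrite -(mxfun1 (posdef_herm posA)); apply: eq_mxfun_posdef => // x _.
exact: powRr0.
Qed.

Lemma mxpow1 : mxpow A 1 = A.
Proof.
rewrite -[RHS](mxfun_id (posdef_herm posA)).
by apply: eq_mxfun_posdef => // x /ltW; exact: powRr1.
Qed.

Lemma mxpowM a b : mxpow (mxpow A a) b = mxpow A (a * b).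
Proof.
rewrite [LHS](mxfun_comp _ _ (posdef_herm posA)).
by apply: eq_mxfun_posdef => // x _; rewrite powRrM.
Qed.

Lemma invmx_mxpow a : invmx (mxpow A a) = mxpow A (- a).
Proof.
by apply: mulmx1_invmx; rewrite -mxpowD subrr mxpow0.
Qed.

End Powers.

Section GeometricMean.
Variable R : realType.
Local Notation C := (complexType R).

(* [L *m L] is the geometric mean of [L *m T *m L] and [L *m invmx T *m L]. *)
Lemma possemidef_block_gmean n (L T : 'M[C]_n) : L \is hermsymmx -> posdef T ->
  possemidef (block_mx (L *m T *m L) (L *m L) (L *m L) (L *m invmx T *m L)).
Proof.
move=> /hermsymmxE hL posT; have hT := hermsymmxE (posdef_herm posT).
have posTV := posdef_possemidef (posdef_inv posT).
have := possemidef_congr (col_mx (L *m T) L) posTV.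
rewrite mul_col_mx trmxC_col_mx mul_col_row.
rewrite trmxCM hL hT (mulmxK (posdef_unit posT)) !mulmxA.
by rewrite (mulmxKV (posdef_unit posT)).
Qed.

Lemma possemidef_block_diag m n (A : 'M[C]_m) (B : 'M[C]_n) :
  possemidef A -> possemidef B -> possemidef (block_mx A 0 0 B).
Proof.
move=> /(possemidef_congr (col_mx 1%:M 0 : 'M_(m + n, m))) posA.
move=> /(possemidef_congr (col_mx 0 1%:M : 'M_(m + n, n))) /(possemidefD posA).
rewrite !trmxC_col_mx !trmxC0 !trmxC1 !mul_col_mx !mul_mx_row.
rewrite !mul0mx !mul1mx !mulmx0 !mulmx1 -!block_mxEv add_block_mx.
by rewrite !addr0 !add0r.
Qed.

Lemma possemidef_block_lemx n (S1 S2 T1 T2 G : 'M[C]_n) :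
  lemx S1 T1 -> lemx S2 T2 ->
  possemidef (block_mx S1 G G S2) -> possemidef (block_mx T1 G G T2).
Proof.
move=> leST1 leST2 /possemidefD/(_ (possemidef_block_diag leST1 leST2)).
by rewrite add_block_mx !addr0 ![_ + (_ - _)]addrC !subrK.
Qed.

Lemma cvx_block_mx m n t (A1 B1 : 'M[C]_m) A2 B2 A3 B3 (A4 B4 : 'M[C]_n) :
  cvx t (block_mx A1 A2 A3 A4) (block_mx B1 B2 B3 B4) =
  block_mx (cvx t A1 B1) (cvx t A2 B2) (cvx t A3 B3) (cvx t A4 B4).
Proof. by rewrite /cvx !scale_block_mx add_block_mx. Qed.

Lemma possemidef_lyapunov n (K T : 'M[C]_n) : K \is hermsymmx -> posdef T ->
  possemidef (K *m T + T *m K) -> possemidef K.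
Proof.
move=> /hermsymmx_spectral[P [e diagK]] posT.
move=> /(possemidef_congr P)/possemidefP posKT.
apply/(possemidef_diag diagK) => i; have [unitP defK] := diagK.
have /posdefP/(_ 'e_i) := posdef_congr (unitarymx_row_free unitP) posT.
have := posKT 'e_i; rewrite !formee; set T' := P *m T *m P^t*.
have -> : P *m (K *m T + T *m K) *m P^t* = rdiag e *m T' + T' *m rdiag e.
  rewrite (diagonalizes_rdiag diagK) /T' mulmxDr mulmxDl !mulmxA.
  by rewrite !(mulmxKtV _ unitP erefl).
rewrite mxE mul_rdiag_mx mul_mx_rdiag mulrC -mulrDr => T'e_ge0 T'_gt0.
have {}T'_gt0 : 0 < T' i i.
  by apply: T'_gt0; apply/rV0Pn; exists i; rewrite mxE !eqxx oner_eq0.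
by move: T'e_ge0; rewrite (pmulr_rge0 _ T'_gt0) -realCD realC_ge0; lra.
Qed.

(* After the congruence by [invmx L], the block matrix is tested on the pairs
   [(v, - v *m T)]. *)
Lemma gmean_max n (L T G : 'M[C]_n) : posdef L -> posdef T -> G \is hermsymmx ->
  possemidef (block_mx (L *m T *m L) G G (L *m invmx T *m L)) ->
  lemx G (L *m L).
Proof.
move=> posL posT /hermsymmxE hG posB.
have [unitL unitT] := (posdef_unit posL, posdef_unit posT).
have [hL hT] := (hermsymmxE (posdef_herm posL), hermsymmxE (posdef_herm posT)).
pose K := 1%:M - invmx L *m G *m invmx L.
have hK : K \is hermsymmx.
  by apply/hermsymmxP; rewrite trmxCB trmxC1 !trmxCM trmxC_inv hL hG mulmxA.
have : possemidef K.
  apply: (possemidef_lyapunov hK posT).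
  have := possemidef_congr (row_mx (invmx L) (- (T *m invmx L))) posB.
  rewrite mul_row_block trmxC_row_mx mul_row_col.
  rewrite trmxCN trmxCM trmxC_inv hL hT.
  rewrite !(mulNmx, mulmxN, mulmxDl, mulmxBl, mulmxBr, opprB, opprD) !mulmxA.
  rewrite !(mulVmx unitL, mul1mx, mulmx1, mulmxK unitL, mulmxKV unitL,
            mulmxK unitT).
  by rewrite opprK (mulmxV unitT) mul1mx addrC [- _ + T]addrC.
move=> /(possemidef_congr L); rewrite hL /K mulmxBr mulmxBl mulmx1 !mulmxA.
by rewrite (mulmxV unitL) mul1mx (mulmxKV unitL).
Qed.

End GeometricMean.

Local Notation "A *t B" :=
  (mxtens.tensmx A B) (at level 40, left associativity).

Section Tensor.
Variable R : realType.
Local Notation C := (complexType R).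

Lemma trmxC_tens m n p q (A : 'M[C]_(m, n)) (B : 'M[C]_(p, q)) :
  (A *t B)^t* = A^t* *t B^t*.
Proof. by rewrite mxtens.trmx_tens mxtens.map_mxT. Qed.

Lemma cvx_tensl m n p q t (A B : 'M[C]_(m, n)) (D : 'M[C]_(p, q)) :
  cvx t A B *t D = cvx t (A *t D) (B *t D).
Proof. by apply/matrixP => i j; rewrite !mxE mulrDl !mulrA. Qed.

Lemma cvx_tensr m n p q t (A B : 'M[C]_(m, n)) (D : 'M[C]_(p, q)) :
  D *t cvx t A B = cvx t (D *t A) (D *t B).
Proof.
by apply/matrixP => i j; rewrite !mxE mulrDr !mulrA ![D _ _ * _]mulrC.
Qed.

Lemma sum_mxtens_index (V : nmodType) m n (F : 'I_(m * n) -> V) :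
  \sum_k F k = \sum_i \sum_j F (mxtens.mxtens_index (i, j)).
Proof.
rewrite pair_big /= (reindex (@mxtens.mxtens_index m n)) /=.
  by apply: eq_bigr => -[].
by exists (@mxtens.mxtens_unindex m n) => k _;
  [exact: mxtens.mxtens_indexK | exact: mxtens.mxtens_unindexK].
Qed.

Definition tens_diag m n (d : 'I_m -> R) (e : 'I_n -> R) (k : 'I_(m * n)) : R :=
  d (mxtens.mxtens_unindex k).1 * e (mxtens.mxtens_unindex k).2.

Lemma rdiag_tens m n (d : 'I_m -> R) (e : 'I_n -> R) :
  rdiag d *t rdiag e = rdiag (tens_diag d e).
Proof.
apply/matrixP => k l; case: (mxtens.mxtens_indexP k) => i j.
case: (mxtens.mxtens_indexP l) => i' j'; rewrite mxtens.tensmxE !mxE.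
rewrite (can_eq (@mxtens.mxtens_indexK m n)) xpair_eqE /tens_diag.
rewrite !mxtens.mxtens_indexK.
case: (i == i'); case: (j == j'); rewrite ?mulr1n ?mulr0n ?mulr0 ?mul0r //.
by rewrite realCM.
Qed.

Lemma tensmx11 m n : (1%:M : 'M[C]_m) *t (1%:M : 'M[C]_n) = 1%:M.
Proof.
by rewrite -!rdiag1 rdiag_tens; apply: eq_rdiag => k; rewrite /tens_diag mulr1.
Qed.

Lemma unitarymx_tens m n (P : 'M[C]_m) (Q : 'M[C]_n) :
  P \is unitarymx -> Q \is unitarymx -> P *t Q \is unitarymx.
Proof.
move=> /unitarymxP unitP /unitarymxP unitQ; apply/unitarymxP.
by rewrite trmxC_tens mxtens.tensmx_mul unitP unitQ tensmx11.
Qed.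

Lemma diagonalizes_tens m n P d (A : 'M[C]_m) Q e (B : 'M[C]_n) :
  diagonalizes P d A -> diagonalizes Q e B ->
  diagonalizes (P *t Q) (tens_diag d e) (A *t B).
Proof.
move=> [unitP ->] [unitQ ->]; split; first exact: unitarymx_tens.
by rewrite trmxC_tens -rdiag_tens !mxtens.tensmx_mul.
Qed.

Lemma posdef_tens m n (A : 'M[C]_m) (B : 'M[C]_n) :
  posdef A -> posdef B -> posdef (A *t B).
Proof.
move=> /posdef_spectral[P [d [diagA d_gt0]]].
move=> /posdef_spectral[Q [e [diagB e_gt0]]].
by apply/(posdef_diag (diagonalizes_tens diagA diagB)) => k; rewrite mulr_gt0.
Qed.

Lemma diagonalizes1 n : diagonalizes (1%:M : 'M[C]_n) (fun=> 1) 1%:M.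
Proof.
by split; [apply/unitarymxP | rewrite rdiag1]; rewrite trmxC1 !mulmx1.
Qed.

Lemma mxpow_1mx n a : mxpow (1%:M : 'M[C]_n) a = 1%:M.
Proof.
rewrite /mxpow (mxfun_diag _ (diagonalizes1 n)) trmxC1 mul1mx mulmx1.
rewrite -[RHS]rdiag1.
by apply: eq_rdiag => i /=; rewrite powR1.
Qed.

Lemma mxpow_tens1 k n (A : 'M[C]_n) a :
  posdef A -> mxpow ((1%:M : 'M[C]_k) *t A) a = 1%:M *t mxpow A a.
Proof.
move=> /posdef_spectral[P [e [diagA _]]].
rewrite /mxpow (mxfun_diag _ (diagonalizes_tens (diagonalizes1 k) diagA)).
have [_ ->] := diagonalizes_tens (diagonalizes1 k)
                 (diagonalizes_mxfun (fun x => powR x a) diagA).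
suff -> : rdiag ((fun x => powR x a) \o tens_diag (fun=> 1) e) =
    rdiag (tens_diag (fun=> 1) ((fun x => powR x a) \o e)) :> 'M[C]_(k * n).
  by [].
by apply: eq_rdiag => i; rewrite /tens_diag /= !mul1r.
Qed.

Lemma trmxC_trmx m n (A : 'M[C]_(m, n)) : (A^T)^t* = (A^t*)^T.
Proof. by apply/matrixP => i j; rewrite !mxE. Qed.

Lemma diagonalizes_tr n P e (A : 'M[C]_n) :
  diagonalizes P e A -> diagonalizes (P^t*)^T e A^T.
Proof.
case=> unitP ->; split; first by rewrite trmx_unitary trmxC_unitary.
by rewrite !trmx_mul trmxC_trmx trmxCK tr_diag_mx mulmxA.
Qed.

Lemma posdef_tr n (A : 'M[C]_n) : posdef A -> posdef A^T.
Proof.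
move=> /posdef_spectral[P [e [diagA e_gt0]]].
exact/(posdef_diag (diagonalizes_tr diagA)).
Qed.

Lemma mxpow_tr n (A : 'M[C]_n) a : posdef A -> mxpow A^T a = (mxpow A a)^T.
Proof.
move=> /posdef_spectral[P [e [diagA _]]].
rewrite /mxpow (mxfun_diag _ (diagonalizes_tr diagA)).
have diagAa := diagonalizes_mxfun (fun x => powR x a) diagA.
by have [_ ->] := diagonalizes_tr diagAa.
Qed.

End Tensor.

HB.lock Definition tpow (R : realType) n m
    (A : 'M[complexType R]_n) (V : 'M[complexType R]_m) (a b : R) :=
  mxpow A a *t mxpow V b.

Section TensorPowers.
Variable R : realType.
Local Notation C := (complexType R).
Variables (n m : nat) (A : 'M[C]_n) (V : 'M[C]_m).
Hypotheses (posA : posdef A) (posV : posdef V).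

Lemma tpow_posdef a b : posdef (tpow A V a b).
Proof. by rewrite unlock; apply: posdef_tens; exact: mxpow_posdef. Qed.

Lemma tpowD a b c d : tpow A V (a + c) (b + d) = tpow A V a b *m tpow A V c d.
Proof. by rewrite unlock mxtens.tensmx_mul -!mxpowD. Qed.

Lemma tpow0 : tpow A V 0 0 = 1%:M.
Proof. by rewrite unlock !mxpow0 // tensmx11. Qed.

Lemma invmx_tpow a b : invmx (tpow A V a b) = tpow A V (- a) (- b).
Proof.
by apply: mulmx1_invmx; rewrite -tpowD !subrr tpow0.
Qed.

Lemma tpow_gmean r s (u := (r + s) / 2) :
  let L := tpow A V (u / 2) ((1 - u) / 2) in
  let T := tpow A V ((r - s) / 2) ((s - r) / 2) in
  [/\ tpow A V r (1 - r) = L *m T *m L, tpow A V u (1 - u) = L *m L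
    & tpow A V s (1 - s) = L *m invmx T *m L].
Proof.
by split; rewrite ?invmx_tpow -!tpowD; congr (tpow A V _ _); rewrite /u; lra.
Qed.

Lemma possemidef_block_tpow r s (u := (r + s) / 2) :
  possemidef (block_mx (tpow A V r (1 - r)) (tpow A V u (1 - u))
                       (tpow A V u (1 - u)) (tpow A V s (1 - s))).
Proof.
have [-> -> ->] := tpow_gmean r s.
by apply: possemidef_block_gmean; [apply: posdef_herm|]; exact: tpow_posdef.
Qed.

Lemma tpow_gmean_max r s (u := (r + s) / 2) G :
  G \is hermsymmx ->
  possemidef (block_mx (tpow A V r (1 - r)) G G (tpow A V s (1 - s))) ->
  lemx G (tpow A V u (1 - u)).
Proof.
by have [-> -> ->] := tpow_gmean r s; apply: gmean_max; exact: tpow_posdef.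
Qed.

End TensorPowers.

Section Ando.
Variable R : realType.
Local Notation C := (complexType R).
Variables (n m : nat) (A1 A2 : 'M[C]_n) (V1 V2 : 'M[C]_m) (t : R).
Hypotheses (posA1 : posdef A1) (posA2 : posdef A2).
Hypotheses (posV1 : posdef V1) (posV2 : posdef V2) (t01 : 0 <= t <= 1).

Definition tpow_concave_at r := lemx
  (cvx t (tpow A1 V1 r (1 - r)) (tpow A2 V2 r (1 - r)))
  (tpow (cvx t A1 A2) (cvx t V1 V2) r (1 - r)).

Let posA := cvx_posdef t01 posA1 posA2.
Let posV := cvx_posdef t01 posV1 posV2.

Lemma tpow_concave0 : tpow_concave_at 0.
Proof.
rewrite /tpow_concave_at subr0 unlock !mxpow0 // !mxpow1 // cvx_tensr.
exact: lemxx.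
Qed.

Lemma tpow_concave1 : tpow_concave_at 1.
Proof.
rewrite /tpow_concave_at subrr unlock !mxpow0 // !mxpow1 // cvx_tensl.
exact: lemxx.
Qed.

Lemma tpow_concave_midpoint r s :
  tpow_concave_at r -> tpow_concave_at s -> tpow_concave_at ((r + s) / 2).
Proof.
move=> concave_r concave_s; apply: tpow_gmean_max => //.
  by apply/posdef_herm/cvx_posdef => //; exact: tpow_posdef.
apply: possemidef_block_lemx concave_r concave_s _.
rewrite -cvx_block_mx.
by apply: cvx_possemidef => //; exact: possemidef_block_tpow.
Qed.

End Ando.

Section MidpointClosed.
Variable R : realType.

Lemma closed_midpoint_itv01 (E : set R) :
  closed E -> E 0 -> E 1 -> (forall r s, E r -> E s -> E ((r + s) / 2)) ->
  forall r, 0 <= r <= 1 -> E r.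
Proof.
move=> closedE E0 E1 midE r /andP[r_ge0 r_le1]; rewrite (closure_id E).1 //.
have bisect k : exists lo hi, [/\ E lo, E hi, lo <= r <= hi & hi - lo = 2 ^- k].
  elim: k => [|k [lo [hi [Elo Ehi /andP[lo_r r_hi] width]]]].
    by exists 0, 1; split; rewrite ?r_ge0 // subr0 expr0 invr1.
  have halve : 2 ^- k.+1 = (hi - lo) / 2 by rewrite width exprS invfM mulrC.
  have [mid_r|r_mid] := leP ((lo + hi) / 2) r.
    by exists ((lo + hi) / 2), hi; rewrite mid_r r_hi halve; split=> //;
      [exact: midE | lra].
  by exists lo, ((lo + hi) / 2); rewrite lo_r (ltW r_mid) halve; split=> //;
    [exact: midE | lra].
move=> B /nbhs_ballP[d /= d_gt0 ballB]; pose k := (Num.truncn d^-1).+1.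
have [lo [hi [Elo _ /andP[lo_r r_hi] width]]] := bisect k.
exists lo; split=> //; apply: ballB; rewrite /ball /= ger0_norm ?subr_ge0 //.
apply: (@le_lt_trans _ _ (2 ^- k)); first by lra.
rewrite -[d]invrK ltf_pV2 ?posrE ?invr_gt0 ?exprn_gt0 //.
apply: (@lt_le_trans _ _ k%:R); first by rewrite truncnS_gt.
by rewrite -natrX ler_nat ltnW // ltn_expl.
Qed.

Lemma continuous_powR_interpolation (a b : R) :
  0 < a -> 0 < b -> continuous (fun r : R => powR a r * powR b (1 - r)).
Proof.
move=> a_gt0 b_gt0; pose g (s : R) := s * ln a + (1 - s) * ln b.
rewrite (_ : (fun r => _) = expR \o g); last first.
  by apply/funext => s; rewrite /powR !gt_eqF //= expRD.
move=> r; apply: (continuous_comp (f := g) (g := expR));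
  last exact: continuous_expR.
apply: cvgD; apply: cvgMr_tmp; first exact: cvg_id.
by apply: cvgB; [exact: cvg_cst | exact: cvg_id].
Qed.

End MidpointClosed.

Section Lieb.
Variable R : realType.
Local Notation C := (complexType R).

Lemma form_tpow_continuous n m (A : 'M[C]_n) (V : 'M[C]_m) v :
  posdef A -> posdef V ->
  exists2 f : R -> R, continuous f &
    forall r, '[v]_(tpow A V r (1 - r)) = realC (f r).
Proof.
move=> /posdef_spectral[P [d [diagA d_gt0]]].
move=> /posdef_spectral[Q [e [diagV e_gt0]]].
pose w k := Normc.normc ((v *m (P *t Q)^t*) 0 k) ^+ 2.
exists (fun r => \sum_k
    tens_diag (fun i => powR (d i) r) (fun j => powR (e j) (1 - r)) k * w k).
  move=> r; apply: cvg_big => [|k _]; first exact: add_continuous.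
  by apply: cvgMr_tmp; exact: continuous_powR_interpolation.
move=> r; rewrite unlock.
have [_ ->] := diagonalizes_tens (diagonalizes_mxfun (fun x => powR x r) diagA)
                 (diagonalizes_mxfun (fun x => powR x (1 - r)) diagV).
rewrite -[X in _ *m X]trmxCK form_congr form_rdiag rmorph_sum.
by apply: eq_bigr => k _; rewrite [RHS]realCM [X in _ = _ * X]rmorphXn.
Qed.

Local Open Scope classical_set_scope.

Lemma tpow_concave n m (A1 A2 : 'M[C]_n) (V1 V2 : 'M[C]_m) (t r : R) :
  posdef A1 -> posdef A2 -> posdef V1 -> posdef V2 ->
  0 <= t <= 1 -> 0 <= r <= 1 ->
  tpow_concave_at A1 A2 V1 V2 t r.
Proof.
move=> posA1 posA2 posV1 posV2 t01.
have posA := cvx_posdef t01 posA1 posA2.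
have posV := cvx_posdef t01 posV1 posV2.
apply: (@closed_midpoint_itv01 _ (tpow_concave_at A1 A2 V1 V2 t)); last first.
- by move=> r' s; exact: tpow_concave_midpoint.
- exact: tpow_concave1.
- exact: tpow_concave0.
rewrite (_ : tpow_concave_at _ _ _ _ _ = \bigcap_(v in setT)
  [set s | '[v]_(cvx t (tpow A1 V1 s (1 - s)) (tpow A2 V2 s (1 - s))) <=
           '[v]_(tpow (cvx t A1 A2) (cvx t V1 V2) s (1 - s))]); last first.
  apply/seteqP; split=> s => [/lemxP le_s v _ | le_s]; first exact: le_s.
  by apply/lemxP => v; exact: le_s.
apply: closed_bigI => v _.
have [f1 cont1 E1] := form_tpow_continuous v posA1 posV1.
have [f2 cont2 E2] := form_tpow_continuous v posA2 posV2.
have [f cont E] := form_tpow_continuous v posA posV.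
pose h s := f s - (t * f1 s + (1 - t) * f2 s).
rewrite (_ : [set s | _] = h @^-1` [set x | 0 <= x]).
  apply: closed_comp; last exact: closed_ge.
  move=> s _; apply: cvgB; first exact: cont.
  by apply: cvgD; apply: cvgMl_tmp; [exact: cont1 | exact: cont2].
by apply/seteqP; split=> s /=;
  rewrite form_cvx E E1 E2 -!realCM -realCD ler_realC subr_ge0.
Qed.

Local Close Scope classical_set_scope.

Definition tensvec m n (J : 'M[C]_(m, n)) : 'rV[C]_(n * m) :=
  \row_k J (mxtens.mxtens_unindex k).2 (mxtens.mxtens_unindex k).1.

Lemma tensvecE m n (J : 'M[C]_(m, n)) i j :
  tensvec J 0 (mxtens.mxtens_index (i, j)) = J j i.
Proof. by rewrite mxE mxtens.mxtens_indexK. Qed.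

Lemma tensvec_mul_tens m n (J : 'M[C]_(m, n)) (A : 'M[C]_n) (V : 'M[C]_m) :
  tensvec J *m (A *t V) = tensvec (V^T *m J *m A).
Proof.
apply/rowP => k; case: (mxtens.mxtens_indexP k) => i j.
rewrite tensvecE !mxE sum_mxtens_index; apply: eq_bigr => i' _.
rewrite mxE mulr_suml; apply: eq_bigr => j' _.
by rewrite tensvecE mxtens.tensmxE !mxE; ring.
Qed.

Lemma tensvec_inner m n (J K : 'M[C]_(m, n)) :
  (tensvec J *m (tensvec K)^t*) 0 0 = \tr (J *m K^t*).
Proof.
rewrite mxE sum_mxtens_index exchange_big; apply: eq_bigr => j _.
by rewrite mxE; apply: eq_bigr => i _; rewrite !mxE !mxtens.mxtens_indexK.
Qed.

Lemma form_tensvec m n (J : 'M[C]_(m, n)) (A : 'M[C]_n) (V : 'M[C]_m) :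
  '[tensvec J]_(A *t V^T) = \tr (J *m A *m J^t* *m V).
Proof.
rewrite /form tensvec_mul_tens tensvec_inner trmxK -!mulmxA mxtrace_mulC.
by rewrite !mulmxA.
Qed.

Lemma lieb_concavity m n (J : 'M[C]_(m, n)) (A1 A2 : 'M[C]_n) (U1 U2 : 'M[C]_m)
    (t r : R) :
  posdef A1 -> posdef A2 -> posdef U1 -> posdef U2 ->
  0 <= t <= 1 -> 0 <= r <= 1 ->
  realC t * \tr (J *m mxpow A1 r *m J^t* *m mxpow U1 (1 - r)) +
  realC (1 - t) * \tr (J *m mxpow A2 r *m J^t* *m mxpow U2 (1 - r)) <=
  \tr (J *m mxpow (cvx t A1 A2) r *m J^t* *m mxpow (cvx t U1 U2) (1 - r)).
Proof.
move=> posA1 posA2 posU1 posU2 t01 r01.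
have trE (A : 'M[C]_n) (U : 'M[C]_m) : posdef U ->
    \tr (J *m mxpow A r *m J^t* *m mxpow U (1 - r)) =
    '[tensvec J]_(tpow A U^T r (1 - r)).
  by move=> posU; rewrite unlock (mxpow_tr _ posU) form_tensvec.
rewrite [X in realC t * X](trE _ _ posU1).
rewrite [X in realC (1 - t) * X](trE _ _ posU2).
rewrite [leRHS](trE _ _ (cvx_posdef t01 posU1 posU2)).
have /lemxP/(_ (tensvec J)) :=
  tpow_concave posA1 posA2 (posdef_tr posU1) (posdef_tr posU2) t01 r01.
by rewrite form_cvx (linear_cvx trmx).
Qed.

Lemma mxpow_concave n (A1 A2 : 'M[C]_n) (t r : R) :
  posdef A1 -> posdef A2 -> 0 <= t <= 1 -> 0 <= r <= 1 ->
  lemx (cvx t (mxpow A1 r) (mxpow A2 r)) (mxpow (cvx t A1 A2) r).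
Proof.
move=> posA1 posA2 t01 r01; apply/lemxP => v.
have := lieb_concavity v posA1 posA2 (posdef1 R 1) (posdef1 R 1) t01 r01.
rewrite (_ : cvx t 1%:M 1%:M = 1%:M :> 'M[C]_1); last first.
  by rewrite /cvx -scalerDl -realCD subrKC rmorph1 scale1r.
have trE (X : 'M[C]_n) s : \tr (v *m X *m v^t* *m mxpow 1%:M s) = '[v]_X.
  by rewrite mxpow_1mx mulmx1 trace_mx11.
rewrite [X in realC t * X]trE [X in realC (1 - t) * X]trE [leRHS]trE => le_form.
by rewrite form_cvx.
Qed.

End Lieb.

Section PositiveMaps.
Variable R : realType.
Local Notation C := (complexType R).

Definition positive_map n l (Psi : 'M[C]_n -> 'M[C]_l) :=
  forall X, possemidef X -> possemidef (Psi X).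

Lemma strictly_positive_map n l (Psi : {linear 'M[C]_n -> 'M[C]_l}) :
  strictly_positive Psi -> positive_map Psi.
Proof.
move=> sposPsi X posX; apply/possemidefP => v.
have [->|v_neq0] := eqVneq v 0; first by rewrite form0l.
have Psi1_gt0 : 0 < '[v]_(Psi 1%:M).
  by have /posdefP := sposPsi _ (posdef1 R n); exact.
have perturbed e : 0 < e -> 0 < '[v]_(Psi X) + e * '[v]_(Psi 1%:M).
  move=> e_gt0; have posXe := posdefDl posX (posdefZ e_gt0 (posdef1 R n)).
  have /posdefP/(_ v v_neq0) := sposPsi _ posXe.
  by rewrite linearD linearZ form_mxD form_mxZ.
have PsiX_real : '[v]_(Psi X) \is Num.real.
  have := gtr0_real (perturbed 1 ltr01).
  rewrite mul1r => /rpredB/(_ (gtr0_real Psi1_gt0)).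
  by rewrite addrK.
have [//|PsiX_lt0] := real_leP (real0 C) PsiX_real.
have := perturbed (- '[v]_(Psi X) / '[v]_(Psi 1%:M)).
by rewrite divr_gt0 ?oppr_gt0 // divfK ?gt_eqF // subrr ltxx => /(_ isT).
Qed.

Lemma positive_map_lemx n l (Psi : {linear 'M[C]_n -> 'M[C]_l}) X Y :
  positive_map Psi -> lemx X Y -> lemx (Psi X) (Psi Y).
Proof. by move=> posPsi leXY; rewrite /lemx -linearB; exact: posPsi. Qed.

(* The difference of the two sides is a nonnegative multiple of
   ['[b *: x1 - a *: x2]_Q]. *)
Lemma form_perspective_convex n (Q : 'M[C]_n) (x1 x2 : 'rV[C]_n) (t a b : R) :
  possemidef Q -> 0 <= t <= 1 -> 0 < a -> 0 < b ->
  realC (t * a + (1 - t) * b)^-1 * '[cvx t x1 x2]_Q <=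
  realC t * (realC a^-1 * '[x1]_Q) + realC (1 - t) * (realC b^-1 * '[x2]_Q).
Proof.
move=> /possemidefP posQ /andP[t_ge0 t_le1] a_gt0 b_gt0.
have mean_gt0 : 0 < t * a + (1 - t) * b by nra.
rewrite -subr_ge0.
have -> : realC t * (realC a^-1 * '[x1]_Q) +
    realC (1 - t) * (realC b^-1 * '[x2]_Q) -
    realC (t * a + (1 - t) * b)^-1 * '[cvx t x1 x2]_Q =
    realC (t * (1 - t) / ((t * a + (1 - t) * b) * a * b)) *
    '[realC b *: x1 - realC a *: x2]_Q.
  rewrite /cvx !(formDl, formDr, formNl, formNr, formZl, formZr) /= !conj_realC.
  move: '[x1]_Q '[x1, x2]_Q '[x2, x1]_Q '[x2]_Q => q11 q12 q21 q22.
  have a_neq0 : realC a != 0 by rewrite gt_eqF ?realC_gt0.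
  have b_neq0 : realC b != 0 by rewrite gt_eqF ?realC_gt0.
  have mean_neq0 : realC t * realC a + (1 - realC t) * realC b != 0.
    have -> : realC t * realC a + (1 - realC t) * realC b =
        realC (t * a + (1 - t) * b).
      by ring.
    by rewrite gt_eqF ?realC_gt0.
  by field; apply/and3P.
rewrite mulr_ge0 // realC_ge0 divr_ge0 ?mulr_ge0 ?subr_ge0 // ltW //.
Qed.

Lemma posdef_simultaneous_diag n (D1 D2 : 'M[C]_n) : posdef D1 -> posdef D2 ->
  exists S e, [/\ S \in unitmx, forall i, 0 < e i,
    D1 = S^t* *m rdiag (fun=> 1) *m S & D2 = S^t* *m rdiag e *m S].
Proof.
move=> posD1 posD2.
have [T [hT unitT TT]] := posdef_sqrt posD1.
have hT' : (invmx T)^t* = invmx T by rewrite trmxC_inv (hermsymmxE hT).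
have freeT' : row_free (invmx T) by rewrite row_free_unit unitmx_inv.
have := posdef_congr freeT' posD2; rewrite hT'.
move=> /posdef_spectral[P [e [[unitP defM] e_gt0]]].
exists (P *m T), e; split=> //.
- by rewrite unitmx_mul unitT unitarymx_unit.
- rewrite trmxCM (hermsymmxE hT) rdiag1 mulmx1 !mulmxA.
  by rewrite (mulmxKtV _ unitP erefl) TT.
- have -> : D2 = T *m (invmx T *m D2 *m invmx T) *m T.
    by rewrite !mulmxA (mulmxV unitT) mul1mx (mulmxKV unitT).
  by rewrite defM trmxCM (hermsymmxE hT) !mulmxA.
Qed.

Lemma invmx_congr_rdiag n (S : 'M[C]_n) e :
  S \in unitmx -> (forall i, 0 < e i) ->
  invmx (S^t* *m rdiag e *m S) =
  invmx S *m rdiag (fun i => (e i)^-1) *m (invmx S)^t*.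
Proof.
move=> unitS e_gt0; apply: mulmx1_invmx.
rewrite !mulmxA (mulmxK unitS) -(mulmxA (S^t*)) rdiagM.
rewrite (_ : rdiag _ = 1%:M) ?mulmx1; last first.
  by rewrite -rdiag1; apply: eq_rdiag => i; rewrite divff ?gt_eqF.
by rewrite -trmxCM (mulVmx unitS) trmxC1.
Qed.

Lemma possemidef_delta n (k : 'I_n) : possemidef (delta_mx k k : 'M[C]_n).
Proof.
have := possemidef_gram (delta_mx k 0 : 'cV[C]_n).
by rewrite trmx_delta map_delta_mx mul_delta_mx.
Qed.

Lemma form_map_rdiag n l (Psi : {linear 'M[C]_n -> 'M[C]_l}) (Z : 'M[C]_n) e x :
  '[x]_(Psi (Z *m rdiag e *m Z^t*)) =
  \sum_k realC (e k) * '[x]_(Psi (Z *m delta_mx k k *m Z^t*)).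
Proof.
rewrite /rdiag diag_mx_sum_delta mulmx_sumr mulmx_suml linear_sum form_mx_sum.
apply: eq_bigr => k _.
by rewrite mxE -scalemxAr -scalemxAl linearZ form_mxZ.
Qed.

(* In a basis diagonalizing [D1] and [D2] simultaneously, [Psi] is only applied
   to diagonal matrices, so that its positivity suffices. *)
Lemma form_map_inv_convex n l (Psi : {linear 'M[C]_n -> 'M[C]_l})
    (D1 D2 : 'M[C]_n) (x1 x2 : 'rV[C]_l) (t : R) :
  positive_map Psi -> 0 <= t <= 1 -> posdef D1 -> posdef D2 ->
  '[cvx t x1 x2]_(Psi (invmx (cvx t D1 D2))) <=
  realC t * '[x1]_(Psi (invmx D1)) + realC (1 - t) * '[x2]_(Psi (invmx D2)).
Proof.
move=> posPsi t01 posD1 posD2.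
have [S [e [unitS e_gt0 defD1 defD2]]] := posdef_simultaneous_diag posD1 posD2.
pose mean i := t * 1 + (1 - t) * e i.
have mean_gt0 i : 0 < mean i.
  by have := e_gt0 i; case/andP: t01; rewrite /mean; nra.
have defD : cvx t D1 D2 = S^t* *m rdiag mean *m S.
  suff -> : rdiag mean = cvx t (rdiag (fun=> 1)) (rdiag e).
    by rewrite cvx_mulmxr cvx_mulmxl defD1 defD2.
  apply/matrixP => i j; rewrite !mxE [in LHS]realCD ![in LHS]realCM.
  by rewrite mulrnDl !mulrnAr.
have form_inv X d (d_gt0 : forall i, 0 < d i)
    (defX : X = S^t* *m rdiag d *m S) x :
    '[x]_(Psi (invmx X)) = \sum_k realC (d k)^-1 *
      '[x]_(Psi (invmx S *m delta_mx k k *m (invmx S)^t*)).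
  by rewrite defX (invmx_congr_rdiag unitS d_gt0) [LHS]form_map_rdiag.
rewrite (form_inv _ _ mean_gt0 defD) (form_inv _ _ (fun=> ltr01) defD1).
rewrite (form_inv _ _ e_gt0 defD2).
rewrite !mulr_sumr -big_split.
apply: ler_sum => k _; apply: form_perspective_convex => //.
exact/posPsi/possemidef_congr/possemidef_delta.
Qed.

Lemma form_map_inv_convex_lemx n l (Psi : {linear 'M[C]_n -> 'M[C]_l})
    (D1 D2 D : 'M[C]_n) (x1 x2 : 'rV[C]_l) (t : R) :
  positive_map Psi -> 0 <= t <= 1 -> posdef D1 -> posdef D2 -> posdef D ->
  lemx (cvx t D1 D2) D ->
  '[cvx t x1 x2]_(Psi (invmx D)) <=
  realC t * '[x1]_(Psi (invmx D1)) + realC (1 - t) * '[x2]_(Psi (invmx D2)).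
Proof.
move=> posPsi t01 posD1 posD2 posD leD.
apply: le_trans (form_map_inv_convex x1 x2 posPsi t01 posD1 posD2).
have leDV := lemx_inv (cvx_posdef t01 posD1 posD2) posD leD.
by have /lemxP := positive_map_lemx posPsi leDV; exact.
Qed.

End PositiveMaps.

Section Kraus.
Variable R : realType.
Local Notation C := (complexType R).

Lemma trmxC_mxcol n m (p_ : 'I_m -> nat) (B : forall i, 'M[C]_(p_ i, n)) :
  (\mxcol_i B i)^t* = \mxrow_i (B i)^t*.
Proof. by apply/matrixP => i j; rewrite !mxE. Qed.

Lemma trmxC_mxrow n m (p_ : 'I_m -> nat) (B : forall i, 'M[C]_(n, p_ i)) :
  (\mxrow_i B i)^t* = \mxcol_i (B i)^t*.
Proof. by apply/matrixP => i j; rewrite !mxE. Qed.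

Lemma possemidef_delta_block n :
  possemidef (\mxblock_(i < n, j < n) (delta_mx i j : 'M[C]_n)).
Proof.
pose T : 'cV[C]_(\sum_(i < n) n) := \mxcol_(i < n) delta_mx i 0.
suff -> : \mxblock_(i < n, j < n) (delta_mx i j : 'M[C]_n) = T *m T^t*.
  exact: possemidef_gram.
rewrite /T trmxC_mxcol mul_mxcol_mxrow; apply/eq_mxblock => i j.
by rewrite trmx_delta map_delta_mx mul_delta_mx.
Qed.

Lemma tens1_mul_mx k n l (X : 'M[C]_n) (K : 'M[C]_(k * n, l)) s i b :
  ((1%:M *t X) *m K) (mxtens.mxtens_index (s, i)) b =
  \sum_j X i j * K (mxtens.mxtens_index (s, j)) b.
Proof.
rewrite mxE sum_mxtens_index (bigD1 s) //=.
rewrite [X in _ + X]big1 ?addr0 => [|s' s'_neq].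
  by apply: eq_bigr => j _; rewrite mxtens.tensmxE mxE eqxx mul1r.
by apply: big1 => j _; rewrite mxtens.tensmxE mxE eq_sym (negbTE s'_neq) !mul0r.
Qed.

(* The rows of [K] are regrouped from those of the square root of the Choi
   matrix. *)
Lemma completely_positive_kraus n l (Phi : {linear 'M[C]_n -> 'M[C]_l}) :
  completely_positive Phi ->
  exists N (K : 'M[C]_(N * n, l)), forall X, Phi X = K^t* *m (1%:M *t X) *m K.
Proof.
move=> /(_ n _ (possemidef_delta_block n)) /possemidef_sqrt[S hS SS].
pose S_ i := submxrow S i.
have choi i j : Phi (delta_mx i j) = (S_ i)^t* *m S_ j.
  move: SS; rewrite -[X in X *m _](hermsymmxE hS) -(submxrowK S).
  by rewrite trmxC_mxrow mul_mxcol_mxrow => /eq_mxblockP.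
pose K := \matrix_(k, b)
  S_ (mxtens.mxtens_unindex k).2 (mxtens.mxtens_unindex k).1 b.
have KE s i b : K (mxtens.mxtens_index (s, i)) b = S_ i s b.
  by rewrite mxE mxtens.mxtens_indexK.
exists (\sum_(i < n) l)%N, K => X.
apply/matrixP => a b; rewrite {1}(matrix_sum_delta X) linear_sum summxE.
rewrite -mulmxA mxE sum_mxtens_index exchange_big; apply: eq_bigr => i _.
transitivity (\sum_j \sum_s X i j * ((S_ i s a)^* * S_ j s b)).
  rewrite linear_sum summxE; apply: eq_bigr => j _.
  rewrite linearZ mxE choi mxE mulr_sumr; apply: eq_bigr => s _.
  by rewrite !mxE.
rewrite exchange_big; apply: eq_bigr => s _; rewrite tens1_mul_mx mulr_sumr.
apply: eq_bigr => j _.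
have -> : (K^t*) a (mxtens.mxtens_index (s, i)) = (S_ i s a)^*.
  by rewrite [LHS]mxE [X in X^* = _]mxE KE.
by rewrite KE mulrCA.
Qed.

End Kraus.

Section ConvexFunctions.
Variable R : realType.
Local Open Scope classical_set_scope.

Lemma convex_pos_slope (g : R -> R) x y z : convex_pos g ->
  0 < x -> x < y -> y < z -> (g y - g x) / (y - x) <= (g z - g y) / (z - y).
Proof.
move=> convex_g x_gt0 xy yz; have xz := lt_trans xy yz.
have zx_gt0 : 0 < z - x by rewrite subr_gt0.
pose t := (z - y) / (z - x).
have t_zx : t * (z - x) = z - y by rewrite /t divfK // gt_eqF.
have t01 : 0 <= t <= 1.
  rewrite divr_ge0 ?subr_ge0 ?(ltW yz) ?(ltW xz) //=.
  by rewrite ler_pdivrMr // mul1r lerD2l lerN2 ltW.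
have := convex_g _ _ _ x_gt0 (lt_trans x_gt0 xz) t01.
have -> : t * x + (1 - t) * z = y by lra.
move=> /(ler_wpM2r (ltW zx_gt0)).
have -> : (t * g x + (1 - t) * g z) * (z - x) =
    t * (z - x) * g x + (z - x - t * (z - x)) * g z by ring.
rewrite t_zx => interpolation.
by rewrite ler_pdivrMr ?subr_gt0 // mulrAC ler_pdivlMr ?subr_gt0 //; nra.
Qed.

Lemma convex_pos_subgradient (g : R -> R) : convex_pos g ->
  exists c, subgradient_pos g c.
Proof.
move=> convex_g.
pose slopes x :=
  [set s | exists y, [/\ 0 < y, y < x & s = (g x - g y) / (x - y)]].
exists (fun x => sup (slopes x)) => x y x_gt0 y_gt0.
have slopes_ub z : x < z -> ubound (slopes x) ((g z - g x) / (z - x)).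
  by move=> xz s [w [w_gt0 wx ->]]; exact: convex_pos_slope.
have slopes0 : slopes x !=set0.
  by exists ((g x - g (x / 2)) / (x - x / 2)), (x / 2); split=> //; lra.
have [yx|xy|->] := ltgtP y x; last by rewrite subrr mulr0 addr0.
  have : (g x - g y) / (x - y) <= sup (slopes x).
    apply: ub_le_sup; last by exists y.
    by exists ((g (x + 1) - g x) / (x + 1 - x)); apply: slopes_ub; lra.
  by rewrite ler_pdivrMr ?subr_gt0 //; lra.
have : sup (slopes x) <= (g y - g x) / (y - x).
  by apply: ge_sup => //; exact: slopes_ub.
by rewrite ler_pdivlMr ?subr_gt0 //; lra.
Qed.

Lemma nondecreasing_pos_subgradient_ge0 (g c : R -> R) :
  nondecreasing_pos g -> subgradient_pos g c ->
  forall x, 0 < x -> 0 <= c x.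
Proof.
move=> nd_g grad x x_gt0.
have := grad x (x / 2) x_gt0; have := nd_g (x / 2) x.
have -> : 0 < x / 2 by lra.
have -> : x / 2 <= x by lra.
move=> /(_ isT isT) le_g /(_ isT) grad_g; nra.
Qed.

Lemma powR_cvx_le (p x y t : R) : 1 <= p -> 0 <= x -> 0 <= y -> 0 <= t <= 1 ->
  powR (t * x + (1 - t) * y) p <= t * powR x p + (1 - t) * powR y p.
Proof.
move=> p_ge1 x_ge0 y_ge0 /andP[t_ge0 t_le1].
have := @convex_powR R p p_ge1 (Itv01 t_ge0 t_le1) x y.
rewrite !inE /= !in_itv /= !andbT => /(_ x_ge0 y_ge0).
by rewrite !convRE.
Qed.

Lemma convex_pos_comp_powR (f : R -> R) a : 0 < a <= 1 -> nondecreasing_pos f ->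
  convex_pos (fun x => f (powR x a)) -> convex_pos f.
Proof.
move=> /andP[a_gt0 a_le1] nd_f convex_fa x y t x_gt0 y_gt0 t01.
have powRK z : 0 < z -> powR (powR z a^-1) a = z.
  by move=> z_gt0; rewrite -powRrM mulVf ?gt_eqF // powRr1 // ltW.
have cvx_gt0 u v : 0 < u -> 0 < v -> 0 < t * u + (1 - t) * v.
  by case/andP: t01; nra.
have xa_gt0 := powR_gt0 a^-1 x_gt0; have ya_gt0 := powR_gt0 a^-1 y_gt0.
have := convex_fa _ _ _ xa_gt0 ya_gt0 t01; rewrite !powRK //; apply: le_trans.
apply: nd_f; first exact: cvx_gt0.
rewrite -[leLHS]powRK; last exact: cvx_gt0.
apply: ge0_ler_powR; first exact: ltW.
- by rewrite nnegrE powR_ge0.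
- by rewrite nnegrE ltW ?cvx_gt0.
- by apply: powR_cvx_le; rewrite ?invf_ge1 // ltW.
Qed.

End ConvexFunctions.

Section Rotation.
Variable R : realType.
Local Notation C := (complexType R).

Lemma polar_coisometry m n (T : 'M[C]_(m, n)) : posdef (T *m T^t*) ->
  exists H E, [/\ H \is hermsymmx, H *m H = T *m T^t*, E \is unitarymx
    & T = H *m E].
Proof.
move=> /posdef_sqrt[H [hH unitH HH]].
exists H, (invmx H *m T); split=> //; last by rewrite (mulKVmx unitH).
apply/unitarymxP; rewrite trmxCM trmxC_inv (hermsymmxE hH) mulmxA.
rewrite -(mulmxA _ T) -HH.
by rewrite mulmxA (mulVmx unitH) mul1mx (mulmxV unitH).
Qed.

Lemma lemx_coisometry m n (E : 'M[C]_(m, n)) :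
  E \is unitarymx -> lemx (E^t* *m E) 1%:M.
Proof.
move=> unitE; rewrite /lemx; set D := 1%:M - _.
suff -> : D = D *m D^t* by exact: possemidef_gram.
rewrite /D trmxCB trmxC1 trmxCM trmxCK mulmxBr mulmx1 mulmxBl mul1mx mulmxA.
by rewrite (mulmxtVK _ unitE) subrr subr0.
Qed.

(* By the polar decompositions of [T] and of [E *m S], where [E] is the
   co-isometric factor of [T]. *)
Lemma mxtrace_gram_rotation m n (T : 'M[C]_(m, n)) (S : 'M[C]_(n, m)) :
  posdef (T *m T^t*) -> exists2 O, O \is unitarymx &
  \tr ((T *m S) *m (T *m S)^t*) <=
  \tr (S^t* *m S *m (O^t* *m (T *m T^t*) *m O)).
Proof.
move=> posTT; have [H [E [hH HH unitE defT]]] := polar_coisometry posTT.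
have [O unitO similar] := gram_unitary_similar (E *m S); exists O => //.
have posV : possemidef (O^t* *m (T *m T^t*) *m O).
  by rewrite -[X in _ *m X]trmxCK; exact/possemidef_congr/possemidef_gram.
have leES : lemx ((E *m S)^t* *m (E *m S)) (S^t* *m S).
  have := lemx_congr (S^t*) (lemx_coisometry unitE).
  by rewrite trmxCK mulmx1 trmxCM !mulmxA.
apply: le_trans (ler_mxtrace_mul posV leES); rewrite similar.
set D := E *m S *m (E *m S)^t*.
have -> : \tr ((T *m S) *m (T *m S)^t*) = \tr (D *m (T *m T^t*)).
  have -> : T *m S = H *m (E *m S) by rewrite mulmxA -defT.
  by rewrite -HH (trmxCM H) (hermsymmxE hH) -mulmxA mxtrace_mulC !mulmxA.
move: (T *m T^t*) => X.
rewrite !mulmxA (mulmxtVK _ unitO) [leRHS]mxtrace_mulC !mulmxA.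
by rewrite (unitarymxP unitO) mul1mx.
Qed.

End Rotation.

Section PowerTrace.
Variable R : realType.
Local Notation C := (complexType R).
Variables (p : R) (f : R -> R).
Hypothesis p_neq1 : p != 1.

Definition power_energy m n (A : 'M[C]_n) (T J : 'M[C]_(m, n)) : C :=
  let Y := T *m (mxpow A (1 - p / 2) *m J^t*) in \tr (Y *m Y^t*).

Lemma mxpow_sqr n (A : 'M[C]_n) : posdef A ->
  mxpow A (2 - p) = mxpow A (1 - p / 2) *m mxpow A (1 - p / 2).
Proof. by move=> posA; rewrite -(mxpowD posA); congr (mxpow A _); lra. Qed.

(* Take the power [1 / (p - 1)] of a unitary conjugate of [T *m T^t*]. *)
Lemma gram_trace_power m n (A : 'M[C]_n) (T J : 'M[C]_(m, n)) :
  posdef A -> posdef (T *m T^t*) ->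
  exists U, [/\ posdef U,
    trf (fun x => f (powR x (p - 1))) U = trf f (T *m T^t*)
    & power_energy A T J <=
      \tr (J *m mxpow A (2 - p) *m J^t* *m mxpow U (p - 1))].
Proof.
move=> posA posTT; have hTT := posdef_herm posTT.
pose S := mxpow A (1 - p / 2) *m J^t*.
have [O unitO le_rot] := mxtrace_gram_rotation S posTT.
have posV : posdef (O^t* *m (T *m T^t*) *m O).
  rewrite -[X in _ *m X]trmxCK; apply: posdef_congr => //.
  by rewrite unitarymx_row_free ?trmxC_unitary.
have hV := posdef_herm posV; have p1_neq0 : p - 1 != 0 by rewrite subr_eq0.
exists (mxpow (O^t* *m (T *m T^t*) *m O) (p - 1)^-1); split.
- exact: mxpow_posdef.
- rewrite (trf_mxfun _ _ hV) -(trf_unitary f hTT unitO).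
  apply: eq_trf_posdef => // x x_gt0 /=.
  by rewrite -powRrM mulVf // powRr1 // ltW.
- rewrite (mxpowM posV) (mulVf p1_neq0) (mxpow1 posV).
  suff -> : J *m mxpow A (2 - p) *m J^t* = S^t* *m S by exact: le_rot.
  have -> : S^t* = J *m mxpow A (1 - p / 2).
    by rewrite trmxCM trmxCK (hermsymmxE (mxpow_herm posA _)).
  by rewrite [in LHS](mxpow_sqr posA) mulmxA [RHS]mulmxA.
Qed.

Lemma gram_dual_factor m n (A : 'M[C]_n) (T : 'M[C]_(m, n)) (W : 'M[C]_m) :
  posdef A -> posdef (T *m T^t*) -> possemidef W ->
  exists2 J : 'M[C]_(m, n), J *m mxpow A (2 - p) *m J^t* = W &
  power_energy A T J = \tr (W *m (T *m T^t*)).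
Proof.
move=> posA /polar_coisometry[H [E [hH <- unitE defT]]]
  /possemidef_sqrt[S hS SS].
have hA := mxpow_herm posA.
have [J JA] : exists J, J *m mxpow A (1 - p / 2) = S *m E.
  exists (S *m E *m mxpow A (p / 2 - 1)).
  rewrite -(mulmxA (S *m E)) -(mxpowD posA).
  by rewrite (_ : p / 2 - 1 + (1 - p / 2) = 0) ?(mxpow0 posA) ?mulmx1; last lra.
have AJ : mxpow A (1 - p / 2) *m J^t* = E^t* *m S.
  rewrite -[S in RHS](hermsymmxE hS) -trmxCM -JA.
  by rewrite trmxCM (hermsymmxE (hA _)).
have TAJ : T *m (mxpow A (1 - p / 2) *m J^t*) = H *m S.
  by rewrite AJ defT -mulmxA (mulmxA E) (unitarymxP unitE) mul1mx.
exists J.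
  rewrite (mxpow_sqr posA) mulmxA JA -mulmxA AJ -mulmxA (mulmxA E).
  by rewrite (unitarymxP unitE) mul1mx.
rewrite /power_energy TAJ trmxCM (hermsymmxE hS) (hermsymmxE hH) -SS.
by rewrite -mulmxA mxtrace_mulC !mulmxA.
Qed.

End PowerTrace.

Section PowerTraceConvexity.
Variable R : realType.
Local Notation C := (complexType R).
Variables (p : R) (f : R -> R).
Hypotheses (p12 : 1 < p <= 2) (nd_f : nondecreasing_pos f).
Hypothesis convex_fp : convex_pos (fun x => f (powR x (p - 1))).

Lemma trf_gram_convex m n (A1 A2 : 'M[C]_n) (T1 T2 T : 'M[C]_(m, n)) (t : R) :
  0 <= t <= 1 -> posdef A1 -> posdef A2 ->
  posdef (T1 *m T1^t*) -> posdef (T2 *m T2^t*) -> posdef (T *m T^t*) ->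
  (forall J, power_energy p (cvx t A1 A2) T J <=
     realC t * power_energy p A1 T1 J +
     realC (1 - t) * power_energy p A2 T2 J) ->
  trf f (T *m T^t*) <= t * trf f (T1 *m T1^t*) + (1 - t) * trf f (T2 *m T2^t*).
Proof.
move=> t01 posA1 posA2 posTT1 posTT2 posTT energy_convex.
have [p_gt1 p_le2] := andP p12.
have p_neq1 : p != 1 by rewrite gt_eqF.
have p1_itv : 0 < p - 1 <= 1 by lra.
have convex_f := convex_pos_comp_powR p1_itv nd_f convex_fp.
have [c grad_f] := convex_pos_subgradient convex_f.
have c_ge0 := nondecreasing_pos_subgradient_ge0 nd_f grad_f.
have [d grad_fp] := convex_pos_subgradient convex_fp.
have [J dualJ energyJ] := gram_dual_factor p (cvx_posdef t01 posA1 posA2) posTT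
                            (mxfun_possemidef posTT c_ge0).
have [U1 [posU1 <- le_energy1]] := gram_trace_power f p_neq1 J posA1 posTT1.
have [U2 [posU2 <- le_energy2]] := gram_trace_power f p_neq1 J posA2 posTT2.
have posU := cvx_posdef t01 posU1 posU2.
apply: le_trans (trf_convex t01 posU1 posU2 grad_fp).
rewrite -(trf_mxfun _ _ (posdef_herm posU)) -/(mxpow _ _) -ler_realC.
apply: le_trans (trf_gradient_posdef posTT (mxpow_posdef posU (p - 1)) grad_f).
rewrite lerDl mulmxBr [X in 0 <= X]raddfB subr_ge0.
rewrite -[leLHS]energyJ -[in leRHS]dualJ.
apply: (le_trans (energy_convex J)).
have r01 : 0 <= 2 - p <= 1 by lra.
have := lieb_concavity J posA1 posA2 posU1 posU2 t01 r01.
rewrite (_ : 1 - (2 - p) = p - 1); last by lra.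
by apply: le_trans; exact: ler_cvx_realC t01 le_energy1 le_energy2.
Qed.

End PowerTraceConvexity.

Section Sandwich.
Variable R : realType.
Local Notation C := (complexType R).

Definition sandwich l (X M : 'M[C]_l) : 'M[C]_l :=
  mxpow X 2^-1 *m M *m mxpow X 2^-1.

Lemma trf_sandwich_gram f m l (W : 'M[C]_(l, m)) (H : 'M[C]_l) :
  posdef (W *m W^t*) -> H \is hermsymmx ->
  trf f (sandwich (W *m W^t*) (H *m H)) = trf f ((H *m W) *m (H *m W)^t*).
Proof.
move=> posWW /hermsymmxE hH; set S := mxpow (W *m W^t*) 2^-1.
have hS : S^t* = S by exact/hermsymmxE/mxpow_herm.
have SS : S *m S = W *m W^t*.
  by rewrite -(mxpowD posWW) (_ : 2^-1 + 2^-1 = 1) ?(mxpow1 posWW) //; lra.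
rewrite /sandwich -/S; move: S hS SS => S hS SS.
have -> : S *m (H *m H) *m S = (S *m H) *m (S *m H)^t*.
  by rewrite trmxCM hS hH !mulmxA.
have -> : (H *m W) *m (H *m W)^t* = (S *m H)^t* *m (S *m H).
  by rewrite (trmxCM H) (trmxCM S) hS hH -(mulmxA H) (mulmxA W) -SS !mulmxA.
exact: trf_gram.
Qed.

Lemma power_energy_form p N l (A : 'M[C]_N) (K : 'M[C]_(N, l)) (H : 'M[C]_l) J :
  posdef A -> H \is hermsymmx ->
  power_energy p A (H *m (K^t* *m mxpow A (p / 2))) J =
  \sum_i '[row i (J *m A *m K)]_(H *m H).
Proof.
move=> posA /hermsymmxE hH; have hA := hermsymmxE (posdef_herm posA).
have halfA : mxpow A (p / 2) *m mxpow A (1 - p / 2) = A.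
  by rewrite -(mxpowD posA) subrKC (mxpow1 posA).
have YE : H *m (K^t* *m mxpow A (p / 2)) *m (mxpow A (1 - p / 2) *m J^t*) =
    (J *m A *m K *m H)^t*.
  rewrite -(mulmxA H) -(mulmxA (K^t*)) (mulmxA (mxpow A _)) halfA.
  by rewrite !trmxCM hH hA.
rewrite /power_energy YE trmxCK mxtrace_mulC trmxCM hH.
by rewrite -mxtrace_congr !mulmxA.
Qed.

Lemma sandwich_factor f p N l (A : 'M[C]_N) (K : 'M[C]_(N, l)) (M : 'M[C]_l) :
  posdef A -> row_free (K^t*) -> posdef M ->
  exists T : 'M[C]_(l, N), [/\ posdef (T *m T^t*),
    trf f (T *m T^t*) = trf f (sandwich (K^t* *m mxpow A p *m K) M)
    & forall J, power_energy p A T J = \sum_i '[row i (J *m A *m K)]_M].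
Proof.
move=> posA freeK posM.
have [H [hH unitH HH]] := posdef_sqrt posM.
have [W [WE WW]] : exists W, W = K^t* *m mxpow A (p / 2) /\
    W *m W^t* = K^t* *m mxpow A p *m K.
  exists (K^t* *m mxpow A (p / 2)); split=> //.
  rewrite trmxCM trmxCK (hermsymmxE (mxpow_herm posA _)) [in RHS](splitr p).
  by rewrite (mxpowD posA) !mulmxA.
have posWW : posdef (W *m W^t*).
  by rewrite WW -[X in _ *m X]trmxCK; exact/posdef_congr/mxpow_posdef.
exists (H *m W); split.
- rewrite trmxCM mulmxA -(mulmxA H); apply: posdef_congr posWW.
  by rewrite row_free_unit.
- by rewrite -WW -HH trf_sandwich_gram.
- by move=> J; rewrite WE power_energy_form ?HH.
Qed.

Lemma invmx_sandwich l (A M : 'M[C]_l) a : posdef A -> M \in unitmx ->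
  invmx (sandwich (mxpow A (- a)) M) = sandwich (mxpow A a) (invmx M).
Proof.
move=> posA unitM; apply: mulmx1_invmx.
have cancel (S S' : 'M[C]_l) : S *m S' = 1%:M ->
    S *m M *m S *m (S' *m invmx M *m S') = 1%:M.
  by move=> SS'; rewrite !mulmxA -(mulmxA (S *m M)) SS' mulmx1 (mulmxK unitM).
apply: cancel; rewrite [X in X *m _](mxpowM posA) [X in _ *m X](mxpowM posA).
by rewrite -(mxpowD posA) mulNr addNr (mxpow0 posA).
Qed.

End Sandwich.

Section PowerForms.
Variable R : realType.
Local Notation C := (complexType R).
Variables (m l : nat) (Psi : {linear 'M[C]_m -> 'M[C]_l}) (q : R).
Hypothesis q10 : - 1 <= q <= 0.

Let r01 : 0 <= - q <= 1.
Proof. by have := q10; lra. Qed.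

Lemma form_map_mxpow_convex (B1 B2 : 'M[C]_m) (x1 x2 : 'rV[C]_l) t :
  positive_map Psi -> 0 <= t <= 1 -> posdef B1 -> posdef B2 ->
  '[cvx t x1 x2]_(Psi (mxpow (cvx t B1 B2) q)) <=
  realC t * '[x1]_(Psi (mxpow B1 q)) + realC (1 - t) * '[x2]_(Psi (mxpow B2 q)).
Proof.
move=> posPsi t01 posB1 posB2; have posB := cvx_posdef t01 posB1 posB2.
have powE (B : 'M[C]_m) : posdef B -> mxpow B q = invmx (mxpow B (- q)).
  by move=> pos; rewrite (invmx_mxpow pos) opprK.
rewrite (powE _ posB) (powE _ posB1) (powE _ posB2).
apply: (form_map_inv_convex_lemx _ _ posPsi t01 (mxpow_posdef posB1 _)
          (mxpow_posdef posB2 _) (mxpow_posdef posB _)).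
exact: mxpow_concave.
Qed.

Lemma form_inv_map_mxpow_convex (B1 B2 : 'M[C]_m) (x1 x2 : 'rV[C]_l) t :
  strictly_positive Psi -> 0 <= t <= 1 -> posdef B1 -> posdef B2 ->
  '[cvx t x1 x2]_(invmx (Psi (mxpow (cvx t B1 B2) (- q)))) <=
  realC t * '[x1]_(invmx (Psi (mxpow B1 (- q)))) +
  realC (1 - t) * '[x2]_(invmx (Psi (mxpow B2 (- q)))).
Proof.
move=> sposPsi t01 posB1 posB2; have posB := cvx_posdef t01 posB1 posB2.
have posPsi (B : 'M[C]_m) : posdef B -> posdef (Psi (mxpow B (- q))).
  by move=> pos; exact/sposPsi/mxpow_posdef.
have pos_id : positive_map (idfun : 'M[C]_l -> 'M[C]_l) by [].
apply: (form_map_inv_convex_lemx (Psi := idfun) _ _ pos_id t01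
          (posPsi _ posB1) (posPsi _ posB2) (posPsi _ posB)).
rewrite -linear_cvx; apply: (positive_map_lemx (strictly_positive_map sposPsi)).
exact: mxpow_concave.
Qed.

End PowerForms.

Lemma eq_jointly_convex (R : realType) n m
    (F G : 'M[complexType R]_n -> 'M[complexType R]_m -> R) :
  (forall A B, F A B = G A B) -> jointly_convex F -> jointly_convex G.
Proof.
move=> FG convexF A1 A2 B1 B2 posA1 posA2 posB1 posB2 t t01.
by rewrite -!FG; exact: convexF.
Qed.

Section JointConvexity.
Variable R : realType.
Local Notation C := (complexType R).
Variables (p : R) (f : R -> R).
Hypotheses (p12 : 1 < p <= 2) (nd_f : nondecreasing_pos f).
Hypothesis convex_fp : convex_pos (fun x => f (powR x (p - 1))).

Lemma trf_sandwich_convex N l (A1 A2 : 'M[C]_N) (K : 'M[C]_(N, l))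
    (M1 M2 M : 'M[C]_l) (t : R) :
  0 <= t <= 1 -> posdef A1 -> posdef A2 -> row_free (K^t*) ->
  posdef M1 -> posdef M2 -> posdef M ->
  (forall x1 x2, '[cvx t x1 x2]_M <=
     realC t * '[x1]_M1 + realC (1 - t) * '[x2]_M2) ->
  trf f (sandwich (K^t* *m mxpow (cvx t A1 A2) p *m K) M) <=
  t * trf f (sandwich (K^t* *m mxpow A1 p *m K) M1) +
  (1 - t) * trf f (sandwich (K^t* *m mxpow A2 p *m K) M2).
Proof.
move=> t01 posA1 posA2 freeK posM1 posM2 posM form_convex.
have posA := cvx_posdef t01 posA1 posA2.
have [T1 [posTT1 trT1 energy1]] := sandwich_factor f p posA1 freeK posM1.
have [T2 [posTT2 trT2 energy2]] := sandwich_factor f p posA2 freeK posM2.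
have [T [posTT trT energy]] := sandwich_factor f p posA freeK posM.
rewrite -[leLHS]trT -[X in t * X]trT1 -[X in (1 - t) * X]trT2.
apply: (trf_gram_convex p12 nd_f convex_fp t01 posA1 posA2 posTT1 posTT2 posTT).
move=> J; rewrite [leLHS]energy [X in realC t * X]energy1.
rewrite [X in realC (1 - t) * X]energy2.
rewrite !mulr_sumr -big_split; apply: ler_sum => i _ /=.
by rewrite cvx_mulmxr cvx_mulmxl (linear_cvx (row i)).
Qed.

Variables (m l : nat) (Psi : {linear 'M[C]_m -> 'M[C]_l}) (q : R).
Hypotheses (sposPsi : strictly_positive Psi) (q10 : - 1 <= q <= 0).

Lemma trf_sandwich_map_convex n (Phi : {linear 'M[C]_n -> 'M[C]_l}) :
  strictly_positive Phi -> completely_positive Phi ->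
  jointly_convex
    (fun A B => trf f (sandwich (Phi (mxpow A p)) (Psi (mxpow B q)))).
Proof.
move=> sposPhi /completely_positive_kraus[N [K PhiE]].
move=> A1 A2 B1 B2 posA1 posA2 posB1 posB2 t t01.
have powE (A : 'M[C]_n) : posdef A ->
    Phi (mxpow A p) = K^t* *m mxpow (1%:M *t A) p *m K.
  by move=> posA; rewrite PhiE (mxpow_tens1 _ _ posA).
have freeK : row_free (K^t*).
  apply: row_free_gram; have := sposPhi _ (posdef1 R n).
  by rewrite PhiE tensmx11 mulmx1 trmxCK.
rewrite [in leLHS](powE _ (cvx_posdef t01 posA1 posA2)) cvx_tensr.
rewrite [in X in t * X](powE _ posA1) [in X in (1 - t) * X](powE _ posA2).
have posI (A : 'M[C]_n) : posdef A -> posdef ((1%:M : 'M[C]_N) *t A).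
  exact/posdef_tens/posdef1.
have posPsi (B : 'M[C]_m) : posdef B -> posdef (Psi (mxpow B q)).
  by move=> posB; exact/sposPsi/mxpow_posdef.
have posB := cvx_posdef t01 posB1 posB2.
apply: (trf_sandwich_convex t01 (posI _ posA1) (posI _ posA2) freeK
          (posPsi _ posB1) (posPsi _ posB2) (posPsi _ posB)) => x1 x2.
exact: (form_map_mxpow_convex q10 _ _ (strictly_positive_map sposPsi)).
Qed.

Lemma trf_invmx_sandwich_convex :
  jointly_convex (fun A B =>
    trf f (invmx (sandwich (mxpow A (- p)) (Psi (mxpow B (- q)))))).
Proof.
move=> A1 A2 B1 B2 posA1 posA2 posB1 posB2 t t01.
have posPsi (B : 'M[C]_m) : posdef B -> posdef (invmx (Psi (mxpow B (- q)))).
  by move=> posB; exact/posdef_inv/sposPsi/mxpow_posdef.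
have invE (A : 'M[C]_l) (B : 'M[C]_m) : posdef A -> posdef B ->
    invmx (sandwich (mxpow A (- p)) (Psi (mxpow B (- q)))) =
    sandwich ((1%:M)^t* *m mxpow A p *m 1%:M) (invmx (Psi (mxpow B (- q)))).
  move=> posA posB; rewrite trmxC1 mul1mx mulmx1.
  exact/invmx_sandwich/posdef_unit/sposPsi/mxpow_posdef.
have free1 : row_free ((1%:M : 'M[C]_l)^t*).
  by rewrite trmxC1 row_free_unit unitmx1.
have posA := cvx_posdef t01 posA1 posA2.
have posB := cvx_posdef t01 posB1 posB2.
rewrite [in leLHS](invE _ _ posA posB) [in X in t * X](invE _ _ posA1 posB1).
rewrite [in X in (1 - t) * X](invE _ _ posA2 posB2).
apply: (trf_sandwich_convex t01 posA1 posA2 free1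
          (posPsi _ posB1) (posPsi _ posB2) (posPsi _ posB)) => x1 x2.
exact: (form_inv_map_mxpow_convex q10 _ _ sposPsi).
Qed.

End JointConvexity.

Theorem theorem5p4 (R : realType) (n m l : nat)
  (Phi : {linear 'M[R[i]]_n -> 'M[R[i]]_l})
  (Psi : {linear 'M[R[i]]_m -> 'M[R[i]]_l})
  (f : R -> R) (p q : R) :
  strictly_positive Phi -> strictly_positive Psi ->
  nondecreasing_pos f ->
  1 < p <= 2 ->
  convex_pos (fun x => f (powR x (p - 1))) ->
  -1 <= q <= 0 ->
  (completely_positive Phi ->
    jointly_convex (fun (A : 'M[R[i]]_n) (B : 'M[R[i]]_m) =>
      trf f (mxpow (Phi (mxpow A p)) (2^-1) *m Psi (mxpow B q) *m
             mxpow (Phi (mxpow A p)) (2^-1))))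
  /\
  (forall E : n = l, (forall X, Phi X = castmx (E, E) X) ->
    jointly_convex (fun (A : 'M[R[i]]_n) (B : 'M[R[i]]_m) =>
      trf f (invmx (mxpow (Phi (mxpow A (- p))) (2^-1) *m Psi (mxpow B (- q)) *m
                    mxpow (Phi (mxpow A (- p))) (2^-1))))).
Proof.
move=> sposPhi sposPsi nd_f p12 convex_fp q10; split=> [cpPhi | E PhiE].
  exact: trf_sandwich_map_convex.
subst l; apply: (eq_jointly_convex (F := fun A B =>
  trf f (invmx (sandwich (mxpow A (- p)) (Psi (mxpow B (- q))))))) => [A B|].
  by rewrite PhiE castmx_id.
exact: trf_invmx_sandwich_convex.
Qed.
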